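(* Let $p\ge3$ and $\lambda=\lambda_p=2\cos(\pi/p)$. The map sending a primitive hyperbolic conjugacy class $\mathcal C$ of $G_p$ to the irreducible system of poles $P_{\mathcal A}$, where $\mathcal A$ is the $G_p$-equivalence class of $\lambda$-BQFs containing $Q_M$ for $M\in\mathcal C$, is a one-to-one correspondence between primitive hyperbolic conjugacy classes of $G_p$ and ISPs for RPFs on $G_p$. In particular, if the class is represented by a generator product $$W=V_1^{m_1}V_{j_1}V_1^{m_2}V_{j_2}\cdots V_1^{m_\ell}V_{j_\ell},\qquad m_t\ge0,\ 2\le j_t\le p-1,$$ then the set of positive poles is $$\mathcal Z_{\mathcal A}=\{S^{-i}\beta_t:\ 1\le t\le\ell,\ 1\le i\le m_t+1\},$$ where $\beta_t$ is the number whose $\lambda$-CF is purely periodic with period $m_t+2,\underbrace{1,\dots,1}_{j_t-2},m_{t+1}+2,\underbrace{1,\dots,1}_{j_{t+1}-2},\dots,m_{t-1}+2,\underbrace{1,\dots,1}_{j_{t-1}-2}$ (indices taken cyclically mod $\ell$).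
   Context: Let $S=\begin{pmatrix}1&\lambda\\0&1\end{pmatrix}$, $T=\begin{pmatrix}0&-1\\1&0\end{pmatrix}$, $U=ST$, $G_p=\langle S,T\rangle/\{\pm I\}$ acting by Möbius transformations; elements are represented by matrices of positive trace. Hyperbolic: $|\mathrm{tr}|>2$; primitive: not a $k$-th power, $k\ge2$. Conjugacy class generators: $V_j=U^{j-1}S$, $1\le j\le p-1$; every non-elliptic element of $G_p$ is conjugate to a product of the $V_j$ unique up to cyclic permutation. A real number is hyperbolic if fixed by a hyperbolic element; its Hecke-conjugate $\alpha'$ is the other fixed point of the hyperbolic elements fixing $\alpha$. $\lambda$-continued fraction ($\lambda$-CF): for real $\alpha$ set $\alpha_0=\alpha$, $r_j=\lfloor\alpha_j/\lambda\rfloor+1$, $\alpha_{j+1}=1/(r_j\lambda-\alpha_j)$, and write $\alpha=[r_0;r_1,\dots]=r_0\lambda-\frac{1}{r_1\lambda-\cdots}$. A $\lambda$-BQF is $Q=[A,B,C]=Ax^2+Bxy+Cy^2$ with coefficients in $\mathbb Z[\lambda]$, with $G_p$-action $(Q\circ M)(x,y)=Q(ax+by,cx+dy)$ and the induced equivalence. For primitive hyperbolic $M=\begin{pmatrix}a&b\\c&d\end{pmatrix}$ of positive trace, $Q_M=[c,d-a,-b]$ (a hyperbolic form) and $\alpha_M=\frac{a-d+\sqrt{(a+d)^2-4}}{2c}$; for hyperbolic $\alpha$, $Q_\alpha=Q_{M_\alpha}$ where $M_\alpha$ is the primitive hyperbolic element with attracting fixed point $\alpha$. A hyperbolic number $\alpha$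 is simple if $\alpha'<0<\alpha$. For an equivalence class $\mathcal A$ of hyperbolic $\lambda$-BQFs, $\mathcal Z_{\mathcal A}=\{\alpha \text{ simple}: Q_\alpha\in\mathcal A\}$, and the irreducible system of poles (ISP) associated with $\mathcal A$ is $P_{\mathcal A}=\mathcal Z_{\mathcal A}\cup T\mathcal Z_{\mathcal A}$; these are exactly the minimal sets of nonzero poles forced to occur together in rational period functions (RPFs) on $G_p$, i.e. rational $q$ with $q+q|T=0$ and $\sum_{j=0}^{p-1}q|U^j=0$, where $(q|M)(z)=(cz+d)^{-2k}q(Mz)$. *)

(* Defs.v *)
From HB Require Import structures.
From mathcomp Require Import all_boot all_order all_algebra.
From mathcomp Require Import ring lra.
From mathcomp Require Import all_classical all_reals all_analysis.

Set Implicit Arguments.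
Unset Strict Implicit.
Unset Printing Implicit Defensive.

Import Order.TTheory GRing.Theory Num.Theory.
Import numFieldNormedType.Exports.
Local Open Scope classical_set_scope.
Local Open Scope ring_scope.

Definition mx2 (R : realType) (a b c d : R) : 'M[R]_2 :=
  \matrix_(i, j) if i == 0 then (if j == 0 then a else b)
                 else (if j == 0 then c else d).

Definition lam (R : realType) (p : nat) : R := 2 * cos (pi / p%:R).

Definition Smx (R : realType) (p : nat) : 'M[R]_2 := mx2 1 (lam R p) 0 1.
Definition Tmx (R : realType) : 'M[R]_2 := mx2 0 (-1) 1 0.
Definition Umx (R : realType) (p : nat) : 'M[R]_2 := Smx R p * Tmx R.
Definition Vmx (R : realType) (p j : nat) : 'M[R]_2 := Umx R p ^+ j.-1 * Smx R p.

(** The subgroup of SL(2, R) generated by S and T; G_p is its quotient by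
    {1, -1}. *)
Inductive Gamma (R : realType) (p : nat) : 'M[R]_2 -> Prop :=
| Gamma1 : Gamma p 1
| GammaS : Gamma p (Smx R p)
| GammaT : Gamma p (Tmx R)
| GammaM (M N : 'M[R]_2) : Gamma p M -> Gamma p N -> Gamma p (M * N)
| GammaV (M : 'M[R]_2) : Gamma p M -> Gamma p M^-1.

(** The element of G_p represented by the matrix M, as a coset of {1, -1};
    equality in G_p is equality of these cosets. *)
Definition pm (R : realType) (M : 'M[R]_2) : set 'M[R]_2 :=
  [set N | N = M \/ N = - M].

Definition mobius (R : realType) (M : 'M[R]_2) (z : R) : R :=
  (M 0 0 * z + M 0 1) / (M 1 0 * z + M 1 1).

(** The first conjunct excludes the pole of z |-> Mz, where the total division
    of [mobius] returns 0. *)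
Definition fixes (R : realType) (M : 'M[R]_2) (z : R) : Prop :=
  M 1 0 * z + M 1 1 != 0 /\ mobius M z = z.

Definition hyperbolic (R : realType) (p : nat) (M : 'M[R]_2) : Prop :=
  Gamma p M /\ 2 < `|\tr M|.

Definition is_power (R : realType) (p : nat) (M : 'M[R]_2) : Prop :=
  exists (N : 'M[R]_2) (k : nat),
    [/\ Gamma p N, (2 <= k)%N & pm M = pm (N ^+ k)].

Definition prim_hyp (R : realType) (p : nat) (M : 'M[R]_2) : Prop :=
  hyperbolic p M /\ ~ is_power p M.

(** Conjugacy classes of G_p, as sets of elements of G_p. *)
Definition conj_class (R : realType) (p : nat) (M : 'M[R]_2) :
    set (set 'M[R]_2) :=
  [set x | exists2 V, Gamma p V & x = pm (V * M * V^-1)].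

Definition prim_hyp_class (R : realType) (p : nat) : set (set (set 'M[R]_2)) :=
  [set C | exists2 M, prim_hyp p M & C = conj_class p M].

Definition hyperbolic_num (R : realType) (p : nat) (z : R) : Prop :=
  exists2 M, hyperbolic p M & fixes M z.

(** Meaningful when z is hyperbolic: the hyperbolic elements of G_p fixing z
    then share both of their fixed points. *)
Definition hecke_conj (R : realType) (p : nat) (z : R) : R :=
  xget 0 [set z' | z' != z /\
                   exists M, [/\ hyperbolic p M, fixes M z & fixes M z']].

Definition simple_num (R : realType) (p : nat) (z : R) : Prop :=
  hyperbolic_num p z /\ hecke_conj p z < 0 < z.

Definition attracting (R : realType) (M : 'M[R]_2) (z : R) : Prop :=
  fixes M z /\ `|derive1 (mobius M) z| < 1.

Definition alpha_mx (R : realType) (M : 'M[R]_2) : R :=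
  (M 0 0 - M 1 1 + Num.sqrt ((M 0 0 + M 1 1) ^+ 2 - 4)) / (2 * M 1 0).

(** The primitive hyperbolic element M_z with attracting fixed point z, given by
    its representative of positive trace. *)
Definition prim_mx (R : realType) (p : nat) (z : R) : 'M[R]_2 :=
  xget 0 [set M | [/\ prim_hyp p M, 0 < \tr M & attracting M z]].

(** The form [A, B, C] = A x^2 + B x y + C y^2. *)
Record bqf (R : realType) := Bqf { bqfA : R; bqfB : R; bqfC : R }.

Definition bqf_eval (R : realType) (Q : bqf R) (x y : R) : R :=
  bqfA Q * x ^+ 2 + bqfB Q * (x * y) + bqfC Q * y ^+ 2.

(** The coefficients of Q(a x + b y, c x + d y); see [bqf_actE]. *)
Definition bqf_act (R : realType) (Q : bqf R) (M : 'M[R]_2) : bqf R :=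
  let a := M 0 0 in let b := M 0 1 in let c := M 1 0 in let d := M 1 1 in
  Bqf (bqfA Q * a ^+ 2 + bqfB Q * (a * c) + bqfC Q * c ^+ 2)
      (2 * bqfA Q * (a * b) + bqfB Q * (a * d + b * c) + 2 * bqfC Q * (c * d))
      (bqfA Q * b ^+ 2 + bqfB Q * (b * d) + bqfC Q * d ^+ 2).

Lemma bqf_actE (R : realType) (Q : bqf R) (M : 'M[R]_2) (x y : R) :
  bqf_eval (bqf_act Q M) x y =
  bqf_eval Q (M 0 0 * x + M 0 1 * y) (M 1 0 * x + M 1 1 * y).
Proof. by rewrite /bqf_eval /bqf_act /=; ring. Qed.

Definition in_Zlam (R : realType) (p : nat) (x : R) : Prop :=
  exists q : {poly int}, x = (map_poly intr q).[lam R p].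

Definition lambda_bqf (R : realType) (p : nat) (Q : bqf R) : Prop :=
  [/\ in_Zlam p (bqfA Q), in_Zlam p (bqfB Q) & in_Zlam p (bqfC Q)].

Definition bqf_class (R : realType) (p : nat) (Q : bqf R) : set (bqf R) :=
  [set Q' | lambda_bqf p Q' /\ exists2 V, Gamma p V & Q' = bqf_act Q V].

Definition Qmx (R : realType) (M : 'M[R]_2) : bqf R :=
  Bqf (M 1 0) (M 1 1 - M 0 0) (- M 0 1).

Definition Qnum (R : realType) (p : nat) (z : R) : bqf R := Qmx (prim_mx p z).

Definition hyperbolic_bqf (R : realType) (p : nat) (Q : bqf R) : Prop :=
  lambda_bqf p Q /\ exists M, [/\ prim_hyp p M, 0 < \tr M & Q = Qmx M].

Definition hyperbolic_bqf_class (R : realType) (p : nat) : set (set (bqf R)) :=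
  [set A | exists2 Q, hyperbolic_bqf p Q & A = bqf_class p Q].

Definition Zset (R : realType) (p : nat) (A : set (bqf R)) : set R :=
  [set z | simple_num p z /\ A (Qnum p z)].

Definition Pset (R : realType) (p : nat) (A : set (bqf R)) : set R :=
  Zset p A `|` mobius (Tmx R) @` Zset p A.

Definition isp (R : realType) (p : nat) : set (set R) :=
  [set P | exists2 A, hyperbolic_bqf_class p A & P = Pset p A].

(** The class of forms attached to a conjugacy class C: everything equivalent to
    Q_M for some M of positive trace representing an element of C. *)
Definition forms_of (R : realType) (p : nat) (C : set (set 'M[R]_2)) :
    set (bqf R) :=
  [set Q | exists M, [/\ C (pm M), 0 < \tr M & bqf_class p (Qmx M) Q]].

Fixpoint lcf_tail (R : realType) (p : nat) (z : R) (n : nat) : R :=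
  if n is n'.+1 then
    let zn := lcf_tail p z n' in
    ((Num.floor (zn / lam R p) + 1)%:~R * lam R p - zn)^-1
  else z.

Definition lcf_digit (R : realType) (p : nat) (z : R) (n : nat) : int :=
  Num.floor (lcf_tail p z n / lam R p) + 1.

Definition lcf_purely_periodic (R : realType) (p : nat) (z : R)
    (s : seq nat) : Prop :=
  (0 < size s)%N /\
  forall n : nat, lcf_digit p z n = (nth 0%N s (n %% size s))%:Z.

(** A sequence w of pairs (m_t, j_t) encodes the generator product
    V_1^m_1 V_j_1 ... V_1^m_l V_j_l, with t counted from 0. *)
Definition gen_word (p : nat) (w : seq (nat * nat)) : Prop :=
  (0 < size w)%N /\ all (fun mj => (2 <= mj.2 <= p.-1)%N) w.

Definition gen_prod (R : realType) (p : nat) (w : seq (nat * nat)) : 'M[R]_2 :=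
  \prod_(mj <- w) (Vmx R p 1 ^+ mj.1 * Vmx R p mj.2).

Definition cf_period (w : seq (nat * nat)) : seq nat :=
  flatten [seq mj.1.+2 :: nseq (mj.2 - 2) 1%N | mj <- w].

(** beta is the sequence of the numbers beta_t: its t-th term is the unique
    number with period starting at the t-th pair and read cyclically. *)
Definition is_beta (R : realType) (p : nat) (w : seq (nat * nat))
    (beta : nat -> R) : Prop :=
  forall t : nat, (t < size w)%N ->
    forall z : R, lcf_purely_periodic p z (cf_period (rot t w)) <-> z = beta t.

Definition shifted_betas (R : realType) (p : nat) (w : seq (nat * nat))
    (beta : nat -> R) : set R :=
  [set z | exists t i : nat,
    [/\ (t < size w)%N, (1 <= i <= (nth (0%N, 0%N) w t).1.+1)%N
      & z = mobius (Smx R p ^- i) (beta t)]].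

(** [attracting] agrees with the closed formula for the attracting fixed point
    of a hyperbolic matrix of positive trace. *)
Lemma attractingE (R : realType) (M : 'M[R]_2) (z : R) :
  M 0 0 * M 1 1 - M 0 1 * M 1 0 = 1 -> 2 < M 0 0 + M 1 1 -> M 1 0 != 0 ->
  attracting M z <-> z = alpha_mx M.
Proof.
rewrite /attracting /fixes /mobius /alpha_mx.
move: (M 0 0) (M 0 1) (M 1 0) (M 1 1) => a b c d detM trM c0.
have D0 : 0 < (a + d) ^+ 2 - 4 by nra.
have s0 := D0; rewrite -sqrtr_gt0 in s0.
have ss := sqr_sqrtr (ltW D0).
move: s0 ss; set s := Num.sqrt _ => s0 ss.
have derE : c * z + d != 0 ->
    derive1 (fun x => (a * x + b) / (c * x + d)) z = ((c * z + d) ^+ 2)^-1.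
  move=> e0; rewrite derive1E.
  have dd : is_derive z 1 (fun x => c * x + d) c.
    have := is_deriveD (is_deriveZ c (is_derive_id z 1)) (is_derive_cst d z 1).
    by rewrite /GRing.scale /= mulr1 addr0.
  have dn : is_derive z 1 (fun x => a * x + b) a.
    have := is_deriveD (is_deriveZ a (is_derive_id z 1)) (is_derive_cst b z 1).
    by rewrite /GRing.scale /= mulr1 addr0.
  have -> : (fun x => (a * x + b) / (c * x + d)) =
    (fun x => a * x + b) * (fun y => (c * y + d)^-1) by [].
  have dV : derivable (fun y => (c * y + d)^-1) z 1 by apply: derivableV.
  rewrite deriveM //.
  rewrite deriveV // !derive_val /GRing.scale /=.
  rewrite -[RHS]mul1r -detM; by field.
split=> [[[e0 fz] az]|zE].
- rewrite derE // in az.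
  have q : c * z ^+ 2 + (d - a) * z - b = 0.
    have := congr1 (fun x => x * (c * z + d)) fz.
    by rewrite /= divfK // => h; lra.
  move: az; rewrite normfV normrX -exprVn expr_lt1 ?invr_ge0 //.
  rewrite invf_lt1 ?normr_gt0 // => az.
  have : (2 * c * z - (a - d) - s) * (2 * c * z - (a - d) + s) = 0.
    rewrite -subr_sqr ss.
    transitivity (4 * c * (c * z ^+ 2 + (d - a) * z - b)
                  - 4 * (a * d - b * c - 1)); first by ring.
    by rewrite q detM; ring.
  move/eqP; rewrite mulf_eq0 => /orP[] /eqP h.
    apply/eqP; rewrite eq_sym -subr_eq0; apply/eqP.
    rewrite (_ : s = 2 * c * z - (a - d)); last lra.
    by field.
  exfalso; have h' : c * z + d = (a + d - s) / 2 by lra.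
  have lo : 0 < (a + d - s) / 2 by nra.
  have hi : (a + d - s) / 2 < 1 by nra.
  by move: az; rewrite h' gtr0_norm // => az; lra.
- have h' : c * z + d = (a + d + s) / 2 by rewrite zE; field.
  have hi : 1 < (a + d + s) / 2 by lra.
  have e0 : c * z + d != 0 by rewrite h'; apply: lt0r_neq0; lra.
  split; first split=> //.
    apply: (mulIf e0); rewrite divfK //.
    have q : 4 * c * (z * (c * z + d) - (a * z + b)) = 0.
      transitivity ((2 * c * z - (a - d)) ^+ 2 - s ^+ 2
        + 4 * (a * d - b * c - 1) + (s ^+ 2 - ((a + d) ^+ 2 - 4))); first by ring.
      rewrite detM ss (_ : 2 * c * z - (a - d) = s); last by rewrite zE; field.
      by rewrite ss; ring.
    move/eqP: q; rewrite !mulf_eq0 (negbTE c0) pnatr_eq0 /= subr_eq0.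
    by move/eqP.
  rewrite derE // normfV normrX -exprVn expr_lt1 ?invr_ge0 //.
  by rewrite invf_lt1 ?normr_gt0 // h' gtr0_norm // (lt_trans ltr01).
Qed.

(* Main.v *)
Require Import Defs.
From mathcomp Require Import all_boot all_order all_algebra.
From mathcomp Require Import ring lra zify.
From mathcomp Require Import all_classical all_reals all_analysis.

(** Every V_j = [[s_j, s_(j+1)], [s_(j-1), s_j]], with s_j = sin(j pi/p) / sin(pi/p),
    has nonnegative entries, and the images of the positive half-line under
    V_1, ..., V_(p-1) are disjoint.  Hence the V_j freely generate a monoid, which by
    the normal form +-T^e V_(j_1) ... V_(j_n) T^e' consists of all the elements of
    G_p with nonnegative entries.

    A hyperbolic M of positive trace with attracting fixed point z and other fixed
    point z' satisfies z' < 0 < z exactly when all its entries are positive.  So the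
    points of Z_A are the attracting fixed points of the positive conjugates of M.
    Cyclic reduction shows that there is at least one; two of them are conjugate as
    words, that is, cyclic permutations of each other.  Discreteness enters only
    through the following fact: if N in G_p fixes a positive point z fixed by a word
    W, then N W^k is a word for large k, up to sign, and words fixing the same
    positive point commute; so N commutes with W and fixes z' too.  Commuting words
    are powers of a common word, which gives the uniqueness of M_z.

    Finally S^(m+2) T (S T)^(j-2) = S (S^m V_j) S^(-1), so beta_t is the translate by
    lambda of the fixed point of the t-th rotation of the generator product. *)

Set Implicit Arguments.
Unset Strict Implicit.
Unset Printing Implicit Defensive.

Import Order.TTheory GRing.Theory Num.Theory.
Local Open Scope classical_set_scope.
Local Open Scope ring_scope.

(** * Two by two matrices *)

Section Mx2.
Variable R : realType.
Implicit Types (a b c d x y z : R) (M N V : 'M[R]_2).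

Lemma mx2E00 a b c d : mx2 a b c d 0 0 = a. Proof. by rewrite mxE. Qed.
Lemma mx2E01 a b c d : mx2 a b c d 0 1 = b. Proof. by rewrite mxE. Qed.
Lemma mx2E10 a b c d : mx2 a b c d 1 0 = c. Proof. by rewrite mxE. Qed.
Lemma mx2E11 a b c d : mx2 a b c d 1 1 = d. Proof. by rewrite mxE. Qed.
Definition mx2E := (mx2E00, mx2E01, mx2E10, mx2E11).

Lemma mx2P M N : M 0 0 = N 0 0 -> M 0 1 = N 0 1 -> M 1 0 = N 1 0 ->
  M 1 1 = N 1 1 -> M = N.
Proof.
move=> h00 h01 h10 h11; apply/matrixP=> i j.
have ord2 (k : 'I_2) : k = 0 \/ k = 1.
  by case: k => [[|[|]]] // lt; [left | right]; apply: val_inj.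
by case: (ord2 i) => ->; case: (ord2 j) => ->.
Qed.

Lemma mx2_eta M : M = mx2 (M 0 0) (M 0 1) (M 1 0) (M 1 1).
Proof. by apply: mx2P; rewrite mx2E. Qed.

Lemma mulmx2E M N (i j : 'I_2) : (M * N) i j = M i 0 * N 0 j + M i 1 * N 1 j.
Proof.
by rewrite -mulmxE mxE !big_ord_recl big_ord0 addr0;
  congr (_ * _ + M i _ * N _ j); apply: val_inj.
Qed.

Lemma mx2_mul a b c d a' b' c' d' : mx2 a b c d * mx2 a' b' c' d' =
  mx2 (a * a' + b * c') (a * b' + b * d') (c * a' + d * c') (c * b' + d * d').
Proof. by apply: mx2P; rewrite mulmx2E !mx2E. Qed.

Lemma mx2N a b c d : - mx2 a b c d = mx2 (- a) (- b) (- c) (- d).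
Proof. by apply: mx2P; rewrite !mxE. Qed.

Lemma mx2_1 : 1 = mx2 1 0 0 1 :> 'M[R]_2.
Proof. by apply: mx2P; rewrite !mxE. Qed.

Lemma tr2E M : \tr M = M 0 0 + M 1 1.
Proof.
rewrite /mxtrace !big_ord_recl big_ord0 addr0.
by congr (_ + M _ _); apply: val_inj.
Qed.

Definition det2 M := M 0 0 * M 1 1 - M 0 1 * M 1 0.
Definition adj2 M := mx2 (M 1 1) (- M 0 1) (- M 1 0) (M 0 0).

Lemma det2M M N : det2 (M * N) = det2 M * det2 N.
Proof. by rewrite /det2 !mulmx2E; ring. Qed.

Lemma det2_1 : det2 1 = 1.
Proof. by rewrite mx2_1 /det2 !mx2E; ring. Qed.

Lemma mulr_adj2 M : det2 M = 1 -> M * adj2 M = 1.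
Proof.
rewrite /det2 => h; rewrite mx2_1; apply: mx2P; rewrite mulmx2E !mx2E //; lra.
Qed.

Lemma mulr_adj2l M : det2 M = 1 -> adj2 M * M = 1.
Proof.
rewrite /det2 => h; rewrite mx2_1; apply: mx2P; rewrite mulmx2E !mx2E //; lra.
Qed.

Lemma det2_unit M : det2 M = 1 -> M \is a GRing.unit.
Proof. by move=> h; apply/unitrP; exists (adj2 M); rewrite mulr_adj2 ?mulr_adj2l. Qed.

Lemma det2_inv M : det2 M = 1 -> M^-1 = adj2 M.
Proof.
move=> h; apply: (mulrI (det2_unit h)).
by rewrite mulrV ?det2_unit // mulr_adj2.
Qed.

Lemma det2V M : det2 M = 1 -> det2 M^-1 = 1.
Proof.
by move=> h; move: (h); rewrite det2_inv // /det2 !mx2E => <-; ring.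
Qed.

Lemma det2X M n : det2 M = 1 -> det2 (M ^+ n) = 1.
Proof.
by move=> h; elim: n => [|n IH]; rewrite ?expr0 ?det2_1 // exprS det2M h IH mulr1.
Qed.

Lemma tr2_conj V M : det2 V = 1 -> \tr (V * M * V^-1) = \tr M.
Proof.
by move=> h; rewrite -!mulmxE mxtrace_mulC mulmxE mulrA mulVr ?mul1r // det2_unit.
Qed.

Lemma tr2N M : \tr (- M) = - \tr M.
Proof. by rewrite !tr2E !mxE; ring. Qed.

Lemma pmP M N : pm M = pm N <-> M = N \/ M = - N.
Proof.
split=> [h|h].
  have : pm M M by left.
  by rewrite h.
case: h => -> //; apply/seteqP; split=> x [] -> ;
  rewrite /pm /= ?opprK; by [left | right].
Qed.

Lemma pm_refl M : pm M M. Proof. by left. Qed.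

Lemma pm_sym M N : pm M N -> pm N M.
Proof. by case=> ->; [left | right; rewrite opprK]. Qed.

Lemma pm_trans M N V : pm M N -> pm N V -> pm M V.
Proof.
by case=> ->; case=> ->; rewrite ?opprK; [left | right | right | left].
Qed.

Lemma pm_mul M N M' N' : pm M M' -> pm N N' -> pm (M * N) (M' * N').
Proof.
by case=> ->; case=> ->; rewrite ?mulrN ?mulNr ?opprK;
  [left | right | right | left].
Qed.

Lemma pmN M : pm M (- M). Proof. by right. Qed.
(** The value of [Qmx M] at (z, 1): the fixed-point equation with its denominator cleared. *)
Definition qf M z := M 1 0 * z ^+ 2 + (M 1 1 - M 0 0) * z - M 0 1.

(** A root is never a pole: c z + d = 0 would force a z + b = 0, against determinant 1. *)
Lemma fixesP M z : det2 M = 1 -> fixes M z <-> qf M z = 0.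
Proof.
rewrite /fixes /mobius /qf /det2.
move: (M 0 0) (M 0 1) (M 1 0) (M 1 1) => a b c d h; split=> [[e0 fz]|q].
  have := congr1 (fun x => x * (c * z + d)) fz.
  by rewrite /= divfK // => ?; lra.
have e0 : c * z + d != 0.
  apply/eqP=> e; have : a * z + b = z * (c * z + d) by lra.
  rewrite e mulr0 => e'.
  have : a * (c * z + d) - c * (a * z + b) = 1 by rewrite -h; ring.
  rewrite e e' !mulr0 subr0 => /eqP; by rewrite eq_sym oner_eq0.
by split=> //; apply: (mulIf e0); rewrite divfK //; lra.
Qed.

Lemma qfN M z : qf (- M) z = - qf M z.
Proof. by rewrite /qf !mxE; ring. Qed.

Lemma qfV M z : det2 M = 1 -> qf M^-1 z = - qf M z.
Proof. by move=> h; rewrite det2_inv // /qf !mx2E; ring. Qed.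

Lemma qf_pm M N z : pm M N -> qf M z = 0 -> qf N z = 0.
Proof. by case=> -> // h; rewrite qfN h oppr0. Qed.

Lemma qf_uniq M z z' z'' : M 1 0 != 0 -> qf M z = 0 -> qf M z' = 0 ->
  qf M z'' = 0 -> z' != z -> z'' != z -> z'' = z'.
Proof.
rewrite /qf; move: (M 0 0) (M 0 1) (M 1 0) (M 1 1) => a b c d c0 q q' q'' n n'.
have e' : (z' - z) * (c * (z' + z) + (d - a)) = 0.
  transitivity ((c * z' ^+ 2 + (d - a) * z' - b) - (c * z ^+ 2 + (d - a) * z - b)).
    by ring.
  by rewrite q q' subr0.
have e'' : (z'' - z) * (c * (z'' + z) + (d - a)) = 0.
  transitivity ((c * z'' ^+ 2 + (d - a) * z'' - b) - (c * z ^+ 2 + (d - a) * z - b)).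
    by ring.
  by rewrite q q'' subr0.
move/eqP: e'; rewrite mulf_eq0 subr_eq0 (negbTE n) /= => /eqP e'.
move/eqP: e''; rewrite mulf_eq0 subr_eq0 (negbTE n') /= => /eqP e''.
by apply: (mulfI c0); lra.
Qed.

(** Comparing the entries of the two products shows that the triples (c, d - a, -b) of M and N are
    proportional. *)
Lemma comm_qf M N z : M * N = N * M -> M 1 0 != 0 -> qf M z = 0 -> qf N z = 0.
Proof.
move=> h c0 q.
have e00 := congr1 (fun A : 'M[R]_2 => A 0 0) h.
have e10 := congr1 (fun A : 'M[R]_2 => A 1 0) h.
move: e00 e10 q; rewrite /= !mulmx2E /qf => e00 e10 q.
apply: (mulfI c0); rewrite mulr0.
transitivity (N 1 0 * (M 1 0 * z ^+ 2 + (M 1 1 - M 0 0) * z - M 0 1)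
   + (M 1 0 * (N 1 1 - N 0 0) - N 1 0 * (M 1 1 - M 0 0)) * z
   + (N 1 0 * M 0 1 - M 1 0 * N 0 1)); first by ring.
by rewrite q; have -> : M 1 0 * (N 1 1 - N 0 0) - N 1 0 * (M 1 1 - M 0 0) = 0;
  [lra | rewrite mul0r mulr0 !add0r; lra].
Qed.

(** * Positive matrices and the signs of their fixed points *)

Definition posmx M := [/\ 0 < M 0 0, 0 < M 0 1, 0 < M 1 0 & 0 < M 1 1].

Definition conj_root M :=
  (M 0 0 - M 1 1 - Num.sqrt ((M 0 0 + M 1 1) ^+ 2 - 4)) / (2 * M 1 0).

Lemma alpha_roots M : det2 M = 1 -> 2 < \tr M -> 0 < M 1 0 ->
  [/\ qf M (alpha_mx M) = 0, qf M (conj_root M) = 0 & conj_root M < alpha_mx M].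
Proof.
rewrite tr2E /det2 /alpha_mx /conj_root /qf.
move: (M 0 0) (M 0 1) (M 1 0) (M 1 1) => a b c d h t c0.
have D0 : 0 < (a + d) ^+ 2 - 4 by nra.
have s0 := D0; rewrite -sqrtr_gt0 in s0.
have ss := sqr_sqrtr (ltW D0).
move: s0 ss; set s := Num.sqrt _ => s0 ss.
have c0' : c != 0 by rewrite gt_eqF.
split.
(* Determinant 1 turns the discriminant (a + d)^2 - 4 into (a - d)^2 + 4 b c. *)
- apply: (mulfI (_ : 4 * c != 0)); first by rewrite mulf_neq0 ?pnatr_eq0.
  rewrite mulr0; transitivity (s ^+ 2 - ((a - d) ^+ 2 + 4 * b * c)); first by field.
  by rewrite ss; nra.
- apply: (mulfI (_ : 4 * c != 0)); first by rewrite mulf_neq0 ?pnatr_eq0.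
  rewrite mulr0; transitivity (s ^+ 2 - ((a - d) ^+ 2 + 4 * b * c)); first by field.
  by rewrite ss; nra.
- by rewrite ltr_pM2r ?invr_gt0; lra.
Qed.

(** Since b c > 0, the square root of (a - d)^2 + 4 b c exceeds |a - d|. *)
Lemma posmx_roots M : det2 M = 1 -> 2 < \tr M -> posmx M ->
  conj_root M < 0 < alpha_mx M.
Proof.
rewrite tr2E /det2 /alpha_mx /conj_root => + + [].
move: (M 0 0) (M 0 1) (M 1 0) (M 1 1) => a b c d h t a0 b0 c0 d0.
have D0 : 0 < (a + d) ^+ 2 - 4 by nra.
have s0 := D0; rewrite -sqrtr_gt0 in s0.
have ss := sqr_sqrtr (ltW D0).
move: s0 ss; set s := Num.sqrt _ => s0 ss.
have bc : 0 < b * c by rewrite mulr_gt0.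
have lo : a - d - s < 0 by nra.
have hi : 0 < a - d + s by nra.
by rewrite pmulr_llt0 ?pmulr_lgt0 ?invr_gt0 ?lo ?hi //; lra.
Qed.

(** By Vieta, c (z - z') is the positive root of the discriminant, so c > 0; then b = -c z z' > 0,
    and a d = 1 + b c with a + d > 2 makes the diagonal positive. *)
Lemma posmx_of_roots M z' : det2 M = 1 -> 2 < \tr M -> M 1 0 != 0 ->
  0 < alpha_mx M -> qf M z' = 0 -> z' < 0 -> posmx M.
Proof.
rewrite tr2E /det2 /alpha_mx /qf /posmx.
move: (M 0 0) (M 0 1) (M 1 0) (M 1 1) => a b c d h t c0.
have D0 : 0 < (a + d) ^+ 2 - 4 by nra.
have s0 := D0; rewrite -sqrtr_gt0 in s0.
have ss := sqr_sqrtr (ltW D0).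
move: s0 ss; set s := Num.sqrt _ => s0 ss; set z := _ / _ => z0 q' z'0.
have zE : 2 * c * z = a - d + s by rewrite /z; field.
have q : c * z ^+ 2 + (d - a) * z - b = 0.
  apply: (mulfI (_ : 4 * c != 0)); first by rewrite mulf_neq0 ?pnatr_eq0.
  rewrite mulr0; transitivity ((2 * c * z + (d - a)) ^+ 2 - ((a - d) ^+ 2 + 4 * b * c)).
    by ring.
  rewrite zE (_ : a - d + s + (d - a) = s); last by ring.
  by rewrite ss; nra.
have e : c * (z + z') + (d - a) = 0.
  apply: (mulfI (_ : z - z' != 0)); first by rewrite subr_eq0 gt_eqF // (lt_trans z'0).
  by rewrite mulr0; lra.
have e2 : c * (z - z') = s by lra.
have cp : 0 < c.
  have : 0 < c * (z - z') by rewrite e2.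
  by rewrite pmulr_lgt0 // subr_gt0 (lt_trans z'0).
have ez : z * (c * (z + z') + (d - a)) = 0 by rewrite e mulr0.
have bE : b = c * (z * - z') by lra.
have bp : 0 < b by rewrite bE mulr_gt0 // mulr_gt0 // oppr_gt0.
have bc : 0 < b * c by rewrite mulr_gt0.
by split=> //; nra.
Qed.

End Mx2.

(** * The generators V_j *)

Section Words.
Variables (R : realType) (p : nat).
Hypothesis hp : (3 <= p)%N.
Local Notation theta := (pi / p%:R : R).
Local Notation S := (Smx R p).
Local Notation T := (Tmx R).
Local Notation U := (Umx R p).
Local Notation V := (Vmx R p).
Local Notation lambda := (lam R p).

(** The s_n of the introduction: values at cos(pi/p) of the Chebyshev polynomials of the second
    kind, with index n - 1. *)
Definition hsin (n : nat) : R := sin (n%:R * theta) / sin theta.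

Lemma theta_gt0 : 0 < theta.
Proof. by rewrite divr_gt0 ?pi_gt0 // ltr0n; lia. Qed.

Lemma ptheta : p%:R * theta = pi.
Proof. by rewrite mulrC divfK // pnatr_eq0; lia. Qed.

Lemma sin_mul_gt0 n : (0 < n < p)%N -> 0 < sin (n%:R * theta).
Proof.
move=> /andP[n0 np]; apply: sin_gt0_pi.
rewrite mulr_gt0 ?theta_gt0 ?ltr0n //=.
by rewrite -[ltRHS]ptheta ltr_pM2r ?theta_gt0 // ltr_nat.
Qed.

Lemma sin_theta_gt0 : 0 < sin theta.
Proof. by have := @sin_mul_gt0 1; rewrite mul1r; apply; lia. Qed.

Lemma hsin0 : hsin 0 = 0.
Proof. by rewrite /hsin mul0r sin0 mul0r. Qed.

Lemma hsin1 : hsin 1 = 1.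
Proof. by rewrite /hsin mul1r divff // gt_eqF // sin_theta_gt0. Qed.

Lemma hsin_rec n : hsin n.+2 = lambda * hsin n.+1 - hsin n.
Proof.
have s0 : sin theta != 0 by rewrite gt_eqF // sin_theta_gt0.
rewrite /hsin /lam; set x := n.+1%:R * theta.
have -> : n.+2%:R * theta = x + theta by rewrite /x -natr1; ring.
have -> : n%:R * theta = x - theta by rewrite /x -natr1; ring.
by rewrite sinD sinB; field.
Qed.

Lemma hsinp : hsin p = 0.
Proof. by rewrite /hsin ptheta sinpi mul0r. Qed.

Lemma hsin_gt0 n : (0 < n < p)%N -> 0 < hsin n.
Proof. by move=> h; rewrite divr_gt0 ?sin_mul_gt0 ?sin_theta_gt0. Qed.

Lemma hsin_ge0 n : (n <= p)%N -> 0 <= hsin n.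
Proof.
move=> h; case: (eqVneq n 0%N) => [->|n0]; first by rewrite hsin0.
case: (eqVneq n p) => [->|np]; first by rewrite hsinp.
by rewrite ltW // hsin_gt0; lia.
Qed.

(** The determinant of two shifts of one solution of the recurrence does not depend on i; its value
    is read off at i = 0. *)
Lemma hsin_det i k : hsin (i + k) * hsin i.+1 - hsin (i + k).+1 * hsin i = hsin k.
Proof.
elim: i => [|i IH]; first by rewrite add0n hsin0 hsin1; ring.
by rewrite -IH addSn !hsin_rec; ring.
Qed.

Lemma hsin_sqr i : hsin i.+1 ^+ 2 - hsin i.+2 * hsin i = 1.
Proof. by rewrite -hsin1 -(hsin_det i 1) addn1; ring. Qed.

Lemma hsinpS : hsin p.+1 = -1.
Proof.
have e1 := hsin_rec p.-1; have e2 := hsin_det p.-1 1.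
have pE : p.-1.+1 = p by lia.
rewrite addn1 !pE hsinp mulr0 sub0r hsin1 mul0r sub0r in e1 e2.
have pos : 0 < hsin p.-1 by apply: hsin_gt0; lia.
have e3 : hsin p.-1 ^+ 2 = 1.
  by rewrite expr2 -e2 e1 mulNr opprK.
by rewrite e1; congr (- _); nra.
Qed.

(** By [hsin_sqr] the square is 1 plus a product of two nonnegative neighbours. *)
Lemma hsin_ge1 n : (0 < n < p)%N -> 1 <= hsin n.
Proof.
case: n => // n h; have := hsin_sqr n.
have a0 : 0 <= hsin n.+2 by apply: hsin_ge0; lia.
have b0 : 0 <= hsin n by apply: hsin_ge0; lia.
have := hsin_gt0 h; have := mulr_ge0 a0 b0.
by nra.
Qed.

Lemma hsin2 : hsin 2 = lambda.
Proof. by rewrite hsin_rec hsin1 hsin0; ring. Qed.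

Lemma lam_ge1 : 1 <= lambda.
Proof. by rewrite -hsin2 hsin_ge1 //; lia. Qed.

Lemma SmxX n : S ^+ n = mx2 1 (n%:R * lambda) 0 1.
Proof.
elim: n => [|n IH]; first by rewrite expr0 mul0r mx2_1.
by rewrite exprS IH mx2_mul -natr1; congr mx2; ring.
Qed.

Lemma UmxE : U = mx2 lambda (-1) 1 0.
Proof. by rewrite /Umx mx2_mul; congr mx2; ring. Qed.

Lemma TmxT : T * T = -1.
Proof. by rewrite mx2_1 mx2N mx2_mul; congr mx2; ring. Qed.

Lemma VmxE j : V j.+1 = mx2 (hsin j.+1) (hsin j.+2) (hsin j) (hsin j.+1).
Proof.
elim: j => [|j IH].
  by rewrite /Vmx expr0 mul1r hsin2 hsin1 hsin0.
have -> : V j.+2 = U * V j.+1 by rewrite /Vmx /= exprS mulrA.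
rewrite IH UmxE mx2_mul; rewrite !hsin_rec; congr mx2; ring.
Qed.

Lemma Vmx1 : V 1 = S. Proof. by rewrite /Vmx expr0 mul1r. Qed.

Lemma UXV k j : (0 < j)%N -> U ^+ k * V j = V (k + j)%N.
Proof. by case: j => // j _; rewrite /Vmx mulrA -exprD addnS. Qed.

Lemma UV j : (0 < j)%N -> U * V j = V j.+1.
Proof. by move=> j0; rewrite -{1}[U]expr1 UXV. Qed.

Lemma VmxT j : (0 < j)%N -> V j * T = U ^+ j.
Proof. by case: j => // j _; rewrite /Vmx -mulrA exprSr. Qed.

(** T thus plays the role of a letter p, so words and powers of U can be rewritten into each
    other. *)
Lemma Vmxp : V p = T.
Proof.
have pE : p = p.-1.+1 by lia.
rewrite [X in Vmx R p X]pE VmxE -pE hsinp hsinpS; congr mx2.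
have := hsin_sqr p.-1; rewrite -pE hsinp hsinpS => h.
by rewrite expr2 in h; lra.
Qed.

Lemma UmxXp : U ^+ p = -1.
Proof. by rewrite -VmxT ?Vmxp ?TmxT //; lia. Qed.

Lemma Vmx_addp j : (0 < j)%N -> V (j + p)%N = - V j.
Proof. by move=> j0; rewrite addnC -UXV // UmxXp mulN1r. Qed.

Lemma det2_S : det2 S = 1. Proof. by rewrite /det2 !mx2E; ring. Qed.
Lemma det2_T : det2 T = 1. Proof. by rewrite /det2 !mx2E; ring. Qed.

Lemma det2_V j : det2 (V j) = 1.
Proof.
by rewrite /Vmx !det2M det2X ?det2_S ?mulr1 // /Umx det2M det2_S det2_T mulr1.
Qed.

(** * Words in the generators and ping-pong on the positive half-line *)

Definition letter j := (0 < j < p)%N.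
Definition wprod (w : seq nat) : 'M[R]_2 := \prod_(j <- w) V j.

Lemma wprod_nil : wprod [::] = 1. Proof. by rewrite /wprod big_nil. Qed.
Lemma wprod_cons j w : wprod (j :: w) = V j * wprod w.
Proof. by rewrite /wprod big_cons. Qed.
Lemma wprod_cat v w : wprod (v ++ w) = wprod v * wprod w.
Proof. by rewrite /wprod big_cat. Qed.
Lemma wprod_rcons w j : wprod (rcons w j) = wprod w * V j.
Proof. by rewrite -cats1 wprod_cat wprod_cons wprod_nil mulr1. Qed.
Lemma wprod_nseq n j : wprod (nseq n j) = V j ^+ n.
Proof. by elim: n => [|n IH]; rewrite /= ?wprod_nil ?wprod_cons ?IH ?exprS ?expr0. Qed.
Lemma wprod_flatten_nseq n u : wprod (flatten (nseq n u)) = wprod u ^+ n.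
Proof. by elim: n => [|n IH]; rewrite /= ?wprod_nil ?wprod_cat ?IH ?exprS ?expr0. Qed.

Lemma det2_wprod w : det2 (wprod w) = 1.
Proof.
by elim: w => [|j w IH]; rewrite ?wprod_nil ?det2_1 // wprod_cons det2M det2_V IH mulr1.
Qed.

(** The bound 1 on the diagonal is preserved by products and keeps denominators positive on the
    closed half-line. *)
Definition nonneg_diag1 (M : 'M[R]_2) :=
  [/\ 1 <= M 0 0, 0 <= M 0 1, 0 <= M 1 0 & 1 <= M 1 1].

Lemma nonneg_diag1M M N : nonneg_diag1 M -> nonneg_diag1 N -> nonneg_diag1 (M * N).
Proof.
rewrite /nonneg_diag1 => -[a b c d] [a' b' c' d']; rewrite !mulmx2E; split; nra.
Qed.

Lemma nonneg_diag1_V j : letter j -> nonneg_diag1 (V j).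
Proof.
case: j => // j /andP[_ h]; rewrite VmxE /nonneg_diag1 !mx2E.
by split; rewrite ?hsin_ge1 ?hsin_ge0 //; lia.
Qed.

Lemma nonneg_diag1_wprod w : all letter w -> nonneg_diag1 (wprod w).
Proof.
elim: w => [_|j w IH] /=.
  by rewrite wprod_nil mx2_1 /nonneg_diag1 !mx2E; split; lra.
case/andP=> lj lw; rewrite wprod_cons.
by apply: nonneg_diag1M; [apply: nonneg_diag1_V | apply: IH].
Qed.

(** Diagonal entries at least 1 with sum above 2 have product above 1, so b c = a d - 1 > 0. *)
Lemma wprod_posmx w : all letter w -> 2 < `|\tr (wprod w)| -> posmx (wprod w).
Proof.
move=> lw; have [a b c d] := nonneg_diag1_wprod lw.
have h := det2_wprod w; rewrite tr2E ger0_norm; last lra.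
move: a b c d h; rewrite /det2 /posmx.
move: (wprod w 0 0) (wprod w 0 1) (wprod w 1 0) (wprod w 1 1).
move=> a b c d a1 b0 c0 d1 h t.
have bc : 0 < b * c by nra.
split; [lra| | |lra].
  by rewrite lt_neqAle b0 andbT; apply/eqP=> e; rewrite -e mul0r ltxx in bc.
by rewrite lt_neqAle c0 andbT; apply/eqP=> e; rewrite -e mulr0 ltxx in bc.
Qed.

(** Vectors are pairs [(x, y)] standing for the point [x / y]. *)
Definition act (M : 'M[R]_2) (u : R * R) : R * R :=
  (M 0 0 * u.1 + M 0 1 * u.2, M 1 0 * u.1 + M 1 1 * u.2).

Definition posv (u : R * R) := 0 < u.1 /\ 0 < u.2.

Lemma actM M N u : act (M * N) u = act M (act N u).
Proof. by rewrite /act !mulmx2E /=; congr (_, _); ring. Qed.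

Lemma act1 u : act 1 u = u.
Proof. by case: u => x y; rewrite /act mx2_1 !mx2E /=; congr (_, _); ring. Qed.

Lemma act_inj M u v : det2 M = 1 -> act M u = act M v -> u = v.
Proof.
move=> h e; rewrite -[u]act1 -[v]act1 -(mulr_adj2l h) !actM; by rewrite e.
Qed.

Lemma posv_act M u : nonneg_diag1 M -> posv u -> posv (act M u).
Proof. by move=> [a b c d] [x y]; split=> /=; nra. Qed.

(** If i < j, solving V_i u = V_j v for v by the determinant identities gives a negative second
    coordinate. *)
Lemma pingpong i j u v : letter i -> letter j -> posv u -> posv v ->
  act (V i) u = act (V j) v -> i = j.
Proof.
wlog: i j u v / (i < j)%N => [hw|ij].
  case: (ltngtP i j) => [lt|lt|//] li lj pu pv e; first exact: (hw i j u v).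
  by symmetry; apply: (hw j i v u).
move=> li lj [x0 y0] [x0' y0'] e; exfalso.
case: i ij li e => // i ij li; case: j ij lj => // j ij lj.
have [k kE] : exists k, (j = i + k.+1)%N.
  by exists (j - i).-1; move: ij; clear; lia.
rewrite /act !VmxE !mx2E kE => -[e1 e2].
set si := hsin i in e1 e2; set si1 := hsin i.+1 in e1 e2.
set si2 := hsin i.+2 in e1 e2.
have d1 := hsin_det i k.+1; have d2 := hsin_det i.+1 k.
have d3 := hsin_sqr (i + k.+1).
rewrite addSnnS in d2; rewrite -/si -/si1 -/si2 in d1 d2.
move: e1 e2 d1 d2 d3.
set sj := hsin (i + k.+1); set sj1 := hsin (i + k.+1).+1.
set sj2 := hsin (i + k.+1).+2 => e1 e2 d1 d2 d3.
have kp : 0 < hsin k.+1 by apply: hsin_gt0; move: lj; rewrite /letter; lia.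
have k0 : 0 <= hsin k by apply: hsin_ge0; move: lj; rewrite /letter; lia.
have : v.2 = - (hsin k.+1 * u.1 + hsin k * u.2).
  rewrite -d1 -d2.
  transitivity ((sj1 ^+ 2 - sj2 * sj) * v.2); first by rewrite d3 mul1r.
  transitivity (sj1 * (sj * v.1 + sj1 * v.2) - sj * (sj1 * v.1 + sj2 * v.2)).
    by ring.
  by rewrite -e1 -e2; ring.
have := mulr_gt0 kp x0; have := mulr_ge0 k0 (ltW y0); lra.
Qed.

(** Ping-pong peels off the letters one by one. Only single vectors are compared, so equal lengths
    are what excludes a proper prefix. *)
Lemma wprod_inj v w a b : all letter v -> all letter w -> size v = size w ->
  posv a -> posv b -> act (wprod v) a = act (wprod w) b -> v = w.
Proof.
elim: v w => [|i v IH] [|j w] //= /andP[li lv] /andP[lj lw] [sz] pa pb.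
rewrite !wprod_cons (actM (V i)) (actM (V j)) => e.
have pa' := posv_act (nonneg_diag1_wprod lv) pa.
have pb' := posv_act (nonneg_diag1_wprod lw) pb.
have ij := pingpong li lj pa' pb' e; rewrite -ij in e *.
by congr cons; apply: IH => //; apply: act_inj e; apply: det2_V.
Qed.

End Words.

(** * Combinatorics of words *)

(** Euclid's algorithm on the lengths: the shorter word is a prefix of the longer one, and the
    remainder still commutes with it. *)
Lemma comm_words (A : eqType) (x y : seq A) : x ++ y = y ++ x ->
  exists (u : seq A) (a b : nat), x = flatten (nseq a u) /\ y = flatten (nseq b u).
Proof.
have [n] := ubnP (size x + size y); elim: n x y => // n IH x y sz e.
wlog le : x y sz e / (size x <= size y)%N => [hw|].
  case: (leqP (size x) (size y)) => [/hw|/ltnW/hw]; first exact.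
  rewrite addnC => /(_ sz (esym e)) [u [a [b [-> ->]]]].
  by exists u, b, a.
case: (eqVneq x [::]) => [->|x0].
  by exists y, 0%N, 1%N; rewrite /= cats0.
have xE : x = take (size x) y.
  by have := congr1 (take (size x)) e; rewrite take_size_cat // takel_cat.
have yE : y = x ++ drop (size x) y by rewrite {1}xE cat_take_drop.
set y' := drop _ _ in yE.
have e' : x ++ y' = y' ++ x.
  by move: e; rewrite yE -catA => /eqP; rewrite eqseq_cat // eqxx => /eqP.
have sx : (0 < size x)%N by rewrite lt0n size_eq0.
have [||u [a [b [xu yu]]]] := IH x y' => //.
  by move: sz; rewrite yE size_cat; lia.
by exists u, a, (a + b)%N; rewrite nseqD flatten_cat -xu -yu.
Qed.

(** Copies of n are stripped from the front of b until b is shorter than n; then n = b r and v = r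
    b. *)
Lemma conj_words (A : eqType) (n b v : seq A) : n ++ b = b ++ v ->
  exists x y, v = x ++ y /\ n = y ++ x.
Proof.
have [k] := ubnP (size b); elim: k b => // k IH b sz e.
have sE : size n = size v by have := congr1 size e; rewrite !size_cat; lia.
case: (eqVneq n [::]) => [n0|n0].
  exists [::], [::]; split=> //; apply: size0nil.
  by rewrite -sE n0.
have sn : (0 < size n)%N by rewrite lt0n size_eq0.
case: (ltnP (size b) (size n)) => lt.
  have bE : b = take (size b) n.
    have := congr1 (take (size b)) e.
    by rewrite [in RHS]take_size_cat // take_cat lt => ->.
  have nE : n = b ++ drop (size b) n by rewrite {1}bE cat_take_drop.
  exists (drop (size b) n), b; split=> //.
  by move: e; rewrite {1}nE -catA => /eqP; rewrite eqseq_cat // eqxx => /eqP.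
have nE : n = take (size n) b.
  by have := congr1 (take (size n)) e; rewrite take_size_cat // takel_cat.
have bE : b = n ++ drop (size n) b by rewrite {1}nE cat_take_drop.
apply: (IH (drop (size n) b)).
  by rewrite size_drop; lia.
by move: e; rewrite {1 2}bE -!catA => /eqP; rewrite eqseq_cat // eqxx => /eqP.
Qed.

(** * Normal forms in the Hecke group *)

Section HeckeGroup.
Variables (R : realType) (p : nat).
Hypothesis hp : (3 <= p)%N.
Local Notation S := (Smx R p).
Local Notation T := (Tmx R).
Local Notation U := (Umx R p).
Local Notation V := (Vmx R p).
Local Notation lambda := (lam R p).
Local Notation Gamma := (@Gamma R p).
Local Notation wprod := (wprod R p).
Local Notation letter := (letter p).
Implicit Types (M N A B : 'M[R]_2) (w Y : seq nat).

Lemma Gamma_det2 M : Gamma M -> det2 M = 1.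
Proof.
elim=> [|||A B _ hA _ hB|A _ hA].
- exact: det2_1.
- exact: det2_S.
- exact: det2_T.
- by rewrite det2M hA hB mulr1.
- exact: det2V.
Qed.

Lemma Gamma_unit M : Gamma M -> M \is a GRing.unit.
Proof. by move/Gamma_det2/det2_unit. Qed.

Lemma Gamma_opp M : Gamma M -> Gamma (- M).
Proof.
by move=> h; rewrite -mulN1r -TmxT; do 2?apply: GammaM => //; apply: GammaT.
Qed.

Lemma Gamma_pm M N : pm M N -> Gamma M -> Gamma N.
Proof. by case=> -> //; apply: Gamma_opp. Qed.

Lemma Gamma_exp M n : Gamma M -> Gamma (M ^+ n).
Proof.
move=> h; elim: n => [|n IH]; first by rewrite expr0; apply: Gamma1.
by rewrite exprS; apply: GammaM.
Qed.

Lemma Gamma_U : Gamma U.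
Proof. by apply: GammaM; [apply: GammaS | apply: GammaT]. Qed.

Lemma Gamma_Vmx j : Gamma (V j).
Proof. by apply: GammaM; [apply/Gamma_exp/Gamma_U | apply: GammaS]. Qed.

Lemma Gamma_wprod w : Gamma (wprod w).
Proof.
elim: w => [|j w IH]; first by rewrite wprod_nil; apply: Gamma1.
by rewrite wprod_cons; apply: GammaM => //; apply: Gamma_Vmx.
Qed.

(** * Matrix entries in Z[lambda] *)

Lemma in_ZlamD (x y : R) : in_Zlam p x -> in_Zlam p y -> in_Zlam p (x + y).
Proof. by move=> [a ->] [b ->]; exists (a + b); rewrite rmorphD hornerD. Qed.
Lemma in_ZlamM (x y : R) : in_Zlam p x -> in_Zlam p y -> in_Zlam p (x * y).
Proof. by move=> [a ->] [b ->]; exists (a * b); rewrite rmorphM hornerM. Qed.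
Lemma in_ZlamN (x : R) : in_Zlam p x -> in_Zlam p (- x).
Proof. by move=> [a ->]; exists (- a); rewrite rmorphN hornerN. Qed.
Lemma in_Zlam1 : in_Zlam p (1 : R).
Proof. by exists 1; rewrite rmorph1 hornerC. Qed.
Lemma in_Zlam0 : in_Zlam p (0 : R).
Proof. by exists 0; rewrite rmorph0 horner0. Qed.
Lemma in_Zlam_lam : in_Zlam p lambda.
Proof. by exists 'X; rewrite map_polyX hornerX. Qed.

Lemma Gamma_Zlam M : Gamma M ->
  [/\ in_Zlam p (M 0 0), in_Zlam p (M 0 1), in_Zlam p (M 1 0) & in_Zlam p (M 1 1)].
Proof.
have i0 := in_Zlam0; have i1 := in_Zlam1; have il := in_Zlam_lam.
have im := in_ZlamN i1.
elim=> [|||A B _ [a b c d] _ [a' b' c' d']|A /Gamma_det2 dA [a b c d]].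
- by rewrite mx2_1 !mx2E.
- by rewrite !mx2E.
- by rewrite !mx2E.
- by rewrite !mulmx2E; split; apply: in_ZlamD; apply: in_ZlamM.
- by rewrite det2_inv // !mx2E; split=> //; apply: in_ZlamN.
Qed.

Lemma Tmx_inv : T^-1 = - T.
Proof.
by rewrite det2_inv ?det2_T // /adj2 mx2N !mx2E; congr mx2; ring.
Qed.

Lemma Smx_inv : S^-1 = - (T * U ^+ p.-1).
Proof.
apply: (mulrI (det2_unit (det2_S R p))); rewrite mulrV ?det2_unit ?det2_S //.
have pE : p.-1.+1 = p by lia.
by rewrite mulrN mulrA -[S * T]/U -exprS pE UmxXp // opprK.
Qed.

(** Up to sign the inverses of S and T are positive words in S and T, because U^p = -1; so no case
    for inverses is left. *)
Lemma Gamma_monoid_ind (Q : 'M[R]_2 -> Prop) :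
  (forall M N, pm M N -> Q M -> Q N) -> Q 1 -> Q S -> Q T ->
  (forall M N, Q M -> Q N -> Q (M * N)) -> forall M, Gamma M -> Q M.
Proof.
move=> Qpm Q1 QS QT QM M h; suff: Q M /\ Q M^-1 by case.
elim: h => {M} [|||A B hA [QA QA'] hB [QB QB']|A hA [QA QA']].
- by rewrite invr1.
- split=> //; rewrite Smx_inv; apply: (Qpm (T * U ^+ p.-1)); first exact: pmN.
  apply: (QM _ _) => //; elim: p.-1 => [|n IH]; first by rewrite expr0.
  by rewrite exprS; apply: (QM _ _) => //; apply: (QM _ _).
- by split=> //; rewrite Tmx_inv; apply: Qpm QT; apply: pmN.
- by rewrite invrM ?Gamma_unit //; split; apply: (QM _ _).
- by rewrite invrK.
Qed.

Lemma pm_TX (e : bool) : pm (T ^+ (~~ e)) (T * T ^+ e).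
Proof. by case: e; rewrite ?expr0 ?expr1 ?mulr1 ?TmxT; [right | left]. Qed.

(** U raises the first letter by one; from p - 1 it reaches V_p = T, and the word loses one
    letter. *)
Lemma U_wprod j Y : letter j -> all letter Y ->
  exists e Y', [/\ all letter Y', (size Y <= size Y')%N
    & U * wprod (j :: Y) = T ^+ nat_of_bool e * wprod Y'].
Proof.
move=> /andP[j0 jp] lY; rewrite wprod_cons mulrA UV //.
case: (eqVneq j.+1 p) => [->|jp'].
  by exists true, Y; rewrite expr1 Vmxp.
exists false, (j.+1 :: Y); rewrite expr0 mul1r wprod_cons; split=> //=.
by rewrite lY andbT /letter; lia.
Qed.

Definition nform M := exists (e e' : bool) Y,
  all letter Y /\ pm (T ^+ e * wprod Y * T ^+ e') M.

Lemma nform_T M : nform M -> nform (T * M).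
Proof.
move=> [e [e' [Y [lY h]]]]; exists (~~ e), e', Y; split=> //.
apply: pm_trans (pm_mul (pm_refl T) h).
rewrite !mulrA; do 2!(apply: pm_mul; last exact: pm_refl).
exact: pm_TX.
Qed.

Lemma nform_S M : nform M -> nform (S * M).
Proof.
move=> [e [e' [Y [lY h]]]].
suff [f [f' [Y' [lY' h']]]] : nform (S * (T ^+ e * wprod Y * T ^+ e')).
  by exists f, f', Y'; split=> //; apply: pm_trans h' (pm_mul (pm_refl S) h).
case: e {h} => /=; last first.
  exists false, e', (1%N :: Y); split; first by rewrite /= lY andbT /letter; lia.
  by rewrite expr0 !mul1r wprod_cons Vmx1 mulrA; left.
rewrite expr1 !mulrA -[S * T]/U; case: Y lY => [|j Y] /=.
  move=> _; exists false, (~~ e'), [:: 1%N]; split; first by rewrite /= /letter; lia.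
  rewrite expr0 mul1r wprod_cons wprod_nil !mulr1 Vmx1 -[U]/(S * T) -mulrA.
  by apply: pm_mul; [exact: pm_refl | exact: pm_TX].
move=> /andP[lj lY]; have [e [Y' [lY' _ ->]]] := U_wprod lj lY.
by exists e, e', Y'; split=> //; left.
Qed.

Lemma Gamma_nform M : Gamma M -> nform M.
Proof.
move=> h; suff: forall N, nform N -> nform (M * N).
  move=> /(_ 1); rewrite mulr1; apply; exists false, false, [::].
  by rewrite !expr0 wprod_nil !mulr1; split=> //; left.
apply: (Gamma_monoid_ind (Q := fun M => forall N, nform N -> nform (M * N))) h.
- move=> A B AB hA N /hA [e [e' [Y [lY h]]]]; exists e, e', Y; split=> //.
  exact: pm_trans h (pm_mul AB (pm_refl N)).
- by move=> N; rewrite mul1r.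
- exact: nform_S.
- exact: nform_T.
- by move=> A B hA hB N /hB/hA; rewrite mulrA.
Qed.

(** A normal form without a trailing T. The bound n is a reserve of letters: multiplying by S uses
    up at most one, so while the reserve lasts the word never runs out. *)
Definition lform n M := exists (e : bool) Y,
  [/\ all letter Y, (n <= size Y)%N & pm (T ^+ e * wprod Y) M].

Lemma lform_T n M : lform n M -> lform n (T * M).
Proof.
move=> [e [Y [lY sY h]]]; exists (~~ e), Y; split=> //.
apply: pm_trans (pm_mul (pm_refl T) h).
rewrite !mulrA; apply: pm_mul; last exact: pm_refl.
exact: pm_TX.
Qed.

Lemma lform_S n M : lform n.+1 M -> lform n (S * M).
Proof.
move=> [e [Y [lY sY h]]].
suff [f [Y' [lY' sY' h']]] : lform n (S * (T ^+ e * wprod Y)).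
  by exists f, Y'; split=> //; apply: pm_trans h' (pm_mul (pm_refl S) h).
case: e {h} => /=; last first.
  exists false, (1%N :: Y); split=> /=; rewrite ?lY ?andbT /letter; try lia.
  by rewrite expr0 !mul1r wprod_cons Vmx1; left.
rewrite expr1 !mulrA -[S * T]/U; case: Y lY sY => [|j Y] //= /andP[lj lY] sY.
have [e [Y' [lY' sY' ->]]] := U_wprod lj lY.
by exists e, Y'; split=> //; [lia | left].
Qed.

(** The k constructed is the number of factors S in a positive expression of M up to sign. *)
Lemma Gamma_lform M : Gamma M ->
  exists k, forall n N, lform (n + k) N -> lform n (M * N).
Proof.
apply: (Gamma_monoid_ind (Q := fun M => exists k, forall n N,
  lform (n + k) N -> lform n (M * N))) => {M} [A B AB [k hk]||||A B [k hk] [l hl]].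
- exists k => n N /hk [e [Y [lY sY h]]]; exists e, Y; split=> //.
  exact: pm_trans h (pm_mul AB (pm_refl N)).
- by exists 0%N => n N; rewrite addn0 mul1r.
- by exists 1%N => n N; rewrite addn1; apply: lform_S.
- by exists 0%N => n N; rewrite addn0; apply: lform_T.
- by exists (k + l)%N => n N; rewrite addnA => /hl/hk; rewrite mulrA.
Qed.

(** The power w^k has at least k letters, enough reserve for [Gamma_lform]. *)
Lemma Gamma_absorb M w : Gamma M -> all letter w -> w != [::] ->
  exists (k : nat) (e : bool) Y,
    all letter Y /\ pm (T ^+ e * wprod Y) (M * wprod w ^+ k).
Proof.
move=> /Gamma_lform [k hk] lw w0.
have [|e [Y [lY _ h]]] := hk 0%N (wprod w ^+ k); last by exists k, e, Y.
exists false, (flatten (nseq k w)); rewrite expr0 mul1r wprod_flatten_nseq.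
split; last exact: pm_refl.
- by elim: k {hk} => //= k IH; rewrite all_cat lw.
- rewrite add0n; elim: k {hk} => //= k IH; rewrite size_cat.
  by rewrite -add1n leq_add // lt0n size_eq0.
Qed.

(** For a word with entries a, b, c, d, a single T puts the entries a and d into the product with
    opposite signs. With T on both sides the product is, up to sign, [[d, -c], [-b, a]], which is
    nonnegative only for the identity. *)
Lemma nonneg_wprod M : Gamma M -> 0 <= M 0 0 -> 0 <= M 0 1 -> 0 <= M 1 0 ->
  0 <= M 1 1 -> exists2 w, all letter w & M = wprod w.
Proof.
move=> /Gamma_nform [e [e' [Y [lY h]]]].
have [a1 b0 c0 d1] := nonneg_diag1_wprod R hp lY.
have dY := det2_wprod R p Y.
case: e e' h => -[] /=; rewrite ?expr0 ?expr1 ?mul1r ?mulr1; last first.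
- by case=> ->; [exists Y | rewrite !mxE => *; lra].
- rewrite [wprod Y]mx2_eta mx2_mul.
  by case=> ->; rewrite ?mx2N !mx2E => *; lra.
- rewrite [wprod Y]mx2_eta mx2_mul.
  by case=> ->; rewrite ?mx2N !mx2E => *; lra.
- move=> h a b c d; exists [::] => //; rewrite wprod_nil mx2_1.
  move: a1 b0 c0 d1 dY h a b c d; rewrite [wprod Y]mx2_eta /det2 !mx2E !mx2_mul.
  move: (wprod Y 0 0) (wprod Y 0 1) (wprod Y 1 0) (wprod Y 1 1).
  move=> a b c d a1 b0 c0 d1 dY [] ->; rewrite ?mx2N !mx2E => h1 h2 h3 h4.
    by exfalso; lra.
  have b'0 : b = 0 by lra.
  have c'0 : c = 0 by lra.
  rewrite b'0 c'0 in dY *; congr mx2; nra.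
Qed.

(** The matrix is U^k, with trace 2 cos(k pi/p). *)
Lemma tr_elliptic k : (0 < k)%N -> `|\tr (V k * T)| <= 2.
Proof.
case: k => // k _; rewrite VmxE // mx2_mul tr2E !mx2E.
rewrite !mulr0 !mulr1 mulrN1 addr0 add0r.
set th : R := pi / p%:R.
have s0 : sin th != 0 by rewrite gt_eqF // sin_theta_gt0.
have -> : hsin R p k.+2 - hsin R p k = 2 * cos (k.+1%:R * th).
  rewrite /hsin -/th; set x := k.+1%:R * th.
  have -> : k.+2%:R * th = x + th by rewrite /x -natr1; ring.
  have -> : k%:R * th = x - th by rewrite /x -natr1; ring.
  by rewrite sinD sinB; field.
rewrite normrM ger0_norm // -[leRHS]mulr1 ler_pM2l ?ltr0n // ler_norml.
by rewrite cos_geN1 cos_le1.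
Qed.

(** * Conjugating hyperbolic elements to words *)

Definition conj_wprod M := exists A w,
  [/\ Gamma A, all letter w & pm (wprod w) (A * M * A^-1)].

Lemma conj_wprod_conj A M : Gamma A -> conj_wprod (A * M * A^-1) -> conj_wprod M.
Proof.
move=> hA [B [w [hB lw h]]]; exists (B * A), w; split=> //; first exact: GammaM.
by rewrite invrM ?Gamma_unit // !mulrA in h *.
Qed.

Lemma conj_wprod_pm M N : pm M N -> conj_wprod M -> conj_wprod N.
Proof.
move=> MN [A [w [hA lw h]]]; exists A, w; split=> //.
by apply: pm_trans h _; apply: pm_mul (pm_refl _); apply: pm_mul (pm_refl _) _.
Qed.

Lemma conj_wprod_wprod w : all letter w -> conj_wprod (wprod w).
Proof.
by move=> lw; exists 1, w; rewrite mul1r invr1 mulr1; split=> //;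
  [apply: Gamma1 | left].
Qed.

(* Cyclic reduction: conjugating by U^k, for k the last letter, merges it with the
   first letter or cancels both. *)
Lemma conj_wprod_T Y : all letter Y -> 2 < `|\tr (wprod Y * T)| ->
  conj_wprod (wprod Y * T).
Proof.
have [n] := ubnP (size Y); elim: n Y => // n IH Y.
case/lastP: Y => [|Y k] sz.
  by rewrite wprod_nil mul1r tr2E !mx2E addr0 normr0 => _ ?; exfalso; lra.
rewrite all_rcons => /andP[/andP[k0 kp] lY]; case: Y lY sz => [|i Y] /=.
  move=> _ _; rewrite wprod_cons wprod_nil mulr1 => h.
  by have := tr_elliptic k0; rewrite leNgt h.
rewrite size_rcons => /andP[/andP[i0 ip] lY] sz.
have -> : wprod (i :: rcons Y k) * T = V i * wprod Y * U ^+ k.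
  by rewrite wprod_cons wprod_rcons -(VmxT R p k0) !mulrA.
have GUk : Gamma (U ^+ k) by apply/Gamma_exp/Gamma_U.
have cE : U ^+ k * (V i * wprod Y * U ^+ k) * (U ^+ k)^-1 = V (k + i)%N * wprod Y.
  rewrite (mulrA (U ^+ k)) (mulrA (U ^+ k)) UXV // mulrK //; exact: Gamma_unit GUk.
move=> tr; apply: (conj_wprod_conj GUk).
have := tr2_conj (V i * wprod Y * U ^+ k) (Gamma_det2 GUk).
move=> h; rewrite -h in tr; move: tr; rewrite cE => {h cE}.
(* The merged letter is k + i, or k + i - p up to sign, or T. In the last case conjugation by T^-1
   moves the T to the end of a word two letters shorter than the original. *)
case: (ltngtP (k + i)%N p) => ki.
- move=> _; rewrite -wprod_cons; apply: conj_wprod_wprod => /=.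
  by rewrite lY andbT /letter; lia.
- have kE : (k + i = (k + i - p) + p)%N by lia.
  move=> _; rewrite kE Vmx_addp ?subn_gt0 //.
  apply: (conj_wprod_pm (M := V (k + i - p)%N * wprod Y)).
    by rewrite mulNr; right.
  rewrite -wprod_cons; apply: conj_wprod_wprod => /=.
  by rewrite lY andbT /letter; lia.
- rewrite ki Vmxp // => tr.
  have GT : Gamma T^-1 by apply/GammaV/GammaT.
  apply: (conj_wprod_conj GT); move: tr.
  rewrite -(tr2_conj _ (Gamma_det2 GT)) invrK mulrA mulVr ?mul1r; last first.
    exact/Gamma_unit/GammaT.
  by apply: IH => //; lia.
Qed.

(** Conjugation carries a leading T to the end, where it cancels a trailing T up to sign or is
    treated by [conj_wprod_T]. *)
Lemma hyperbolic_conj_wprod M : hyperbolic p M -> conj_wprod M.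
Proof.
move=> [hM tr]; have [e [e' [Y [lY h]]]] := Gamma_nform hM.
apply: (conj_wprod_pm h).
have GT : Gamma T^-1 by apply/GammaV/GammaT.
have uT : T \is a GRing.unit by apply/Gamma_unit/GammaT.
have {tr h} : 2 < `|\tr (T ^+ e * wprod Y * T ^+ e')|.
  by case: h tr => -> //; rewrite tr2N normrN.
case: e e' => -[] /=; rewrite ?expr0 ?expr1 ?mul1r ?mulr1 => tr.
- apply: (conj_wprod_conj GT); rewrite invrK !mulrA mulVr // mul1r -mulrA TmxT.
  by apply: (conj_wprod_pm (M := wprod Y)) (conj_wprod_wprod lY); rewrite mulrN1; right.
- apply: (conj_wprod_conj GT); move: tr.
  rewrite -(tr2_conj _ (Gamma_det2 GT)) invrK mulrA mulVr ?mul1r //.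
  exact: conj_wprod_T.
- exact: conj_wprod_T.
- exact: conj_wprod_wprod.
Qed.

End HeckeGroup.

(** * Fixed points *)

Section FixedPoints.
Variables (R : realType) (p : nat).
Hypothesis hp : (3 <= p)%N.
Local Notation T := (Tmx R).
Local Notation V := (Vmx R p).
Local Notation Gamma := (@Gamma R p).
Local Notation wprod := (wprod R p).
Local Notation letter := (letter p).
Implicit Types (M N A B : 'M[R]_2) (w x n : seq nat) (z : R).

Lemma qfM M N z : qf M z = 0 -> qf N z = 0 -> qf (M * N) z = 0.
Proof.
move=> hM hN.
transitivity ((N 1 0 * z + N 1 1) * qf M z + (M 0 0 - z * M 1 0) * qf N z).
  by rewrite /qf !mulmx2E; ring.
by rewrite hM hN !mulr0 addr0.
Qed.

Lemma qf1 z : qf (1 : 'M[R]_2) z = 0.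
Proof. by rewrite /qf mx2_1 !mx2E; ring. Qed.

Lemma qfX M z k : qf M z = 0 -> qf (M ^+ k) z = 0.
Proof. by move=> h; elim: k => [|k IH]; rewrite ?expr0 ?qf1 // exprS qfM. Qed.

(** The vector (z, 1) is an eigenvector with eigenvalue c z + d. *)
Lemma qf_act M z k : qf M z = 0 ->
  act M (k * z, k) = (k * (M 1 0 * z + M 1 1) * z, k * (M 1 0 * z + M 1 1)).
Proof.
rewrite /act /qf /= => h; congr (_, _); last by ring.
transitivity (k * (M 1 0 * z + M 1 1) * z -
  k * (M 1 0 * z ^+ 2 + (M 1 1 - M 0 0) * z - M 0 1)); first by ring.
by rewrite h mulr0 subr0.
Qed.

(** The words x w and w x have the same length and multiply the common eigenvector (z, 1) by the
    same factor. *)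
Lemma fix_comm_words x w z : all letter x -> all letter w -> 0 < z ->
  qf (wprod x) z = 0 -> qf (wprod w) z = 0 -> x ++ w = w ++ x.
Proof.
move=> lx lw z0 fx fw.
apply: (@wprod_inj R p hp _ _ (1 * z, 1) (1 * z, 1)).
- by rewrite all_cat lx lw.
- by rewrite all_cat lx lw.
- by rewrite !size_cat addnC.
- by split=> /=; lra.
- by split=> /=; lra.
- by rewrite !wprod_cat !actM !qf_act //; congr (_, _); ring.
Qed.

(* A large power of the word absorbs any element N: then N W^k is again a word up
   to sign, and two words fixing the same positive point commute. *)
Lemma fix_comm N w z : Gamma N -> all letter w -> 0 < z ->
  qf N z = 0 -> qf (wprod w) z = 0 -> N * wprod w = wprod w * N.
Proof.
move=> hN lw z0 fN fw.
case: (eqVneq w [::]) => [->|w0]; first by rewrite wprod_nil mulr1 mul1r.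
have [k [e [Y [lY h]]]] := Gamma_absorb hp hN lw w0.
have := qf_pm (pm_sym h) (qfM fN (qfX k fw)).
have [a1 b0 c0 d1] := nonneg_diag1_wprod R hp lY.
case: e h => [h|].
  (* The quadratic of T Y at z is a z^2 + (b + c) z + d, with a, b, c, d the entries of Y; it is
     positive for z > 0. *)
  rewrite /qf expr1 !mulmx2E !mx2E => e; exfalso.
  have := mulr_ge0 b0 (ltW z0); have := mulr_ge0 c0 (ltW z0).
  have : 0 <= wprod Y 0 0 * z ^+ 2 by rewrite mulr_ge0 ?sqr_ge0 //; lra.
  by lra.
rewrite expr0 mul1r => h fY.
have cYW := fix_comm_words lY lw z0 fY fw.
have {}cYW : wprod Y * wprod w = wprod w * wprod Y by rewrite -!wprod_cat cYW.
have c : N * wprod w ^+ k * wprod w = wprod w * (N * wprod w ^+ k).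
  by case: h => ->; rewrite ?mulNr ?mulrN cYW.
have uW : wprod w ^+ k \is a GRing.unit by apply/det2_unit/det2X/det2_wprod.
by apply: (mulIr uW); rewrite -!mulrA -exprS exprSr !mulrA in c *.
Qed.

Lemma posmx_wprod N : Gamma N -> posmx N -> exists2 w, all letter w & N = wprod w.
Proof. by move=> hN [a b c d]; apply: nonneg_wprod => //; apply: ltW. Qed.

Lemma posmx_share N M z z' : Gamma N -> posmx N -> 0 < z -> qf N z = 0 ->
  qf N z' = 0 -> Gamma M -> qf M z = 0 -> qf M z' = 0.
Proof.
move=> hN pN z0 fz fz' hM fM; have [w lw NE] := posmx_wprod hN pN.
have [_ _ c0 _] := pN; rewrite NE in fz fz' c0.
apply: (comm_qf (M := wprod w)) => //; last by rewrite gt_eqF.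
by symmetry; apply: (fix_comm hM lw z0).
Qed.

(** If c = 0, an affine function with two zeros vanishes identically; so a = d, a^2 = 1 and the
    trace is 2 or -2. *)
Lemma two_roots_neq0 M z z' : det2 M = 1 -> 2 < `|\tr M| -> qf M z = 0 ->
  qf M z' = 0 -> z' != z -> M 1 0 != 0.
Proof.
rewrite /det2 tr2E /qf => dM tM fz fz' zz'; apply/eqP=> c0.
rewrite c0 !mul0r !add0r in fz fz'.
have ad : M 1 1 = M 0 0.
  apply/eqP; rewrite -subr_eq0; apply/eqP.
  apply: (mulfI (_ : z - z' != 0)); first by rewrite subr_eq0 eq_sym.
  by rewrite mulr0; lra.
rewrite c0 ad mulr0 subr0 in dM tM.
by case: (leP 0 (M 0 0)) => h; [rewrite ger0_norm in tM | rewrite ltr0_norm in tM]; nra.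
Qed.

(** After a change of sign the trace is positive; b = -c z z' has the sign of c, which passing to
    the inverse makes positive if necessary. *)
Lemma opposite_roots_posmx M z z' : Gamma M -> 2 < `|\tr M| -> z' < 0 < z ->
  qf M z = 0 -> qf M z' = 0 ->
  exists N, [/\ Gamma N, posmx N, qf N z = 0 & qf N z' = 0].
Proof.
move=> hM trM /andP[z'0 z0] fz fz'.
wlog {trM} trM : M hM fz fz' / 2 < \tr M => [hw|].
  case: (leP 0 (\tr M)) => h; first by apply: hw hM fz fz' _; rewrite ger0_norm in trM.
  apply: (hw (- M)); rewrite ?qfN ?fz ?fz' ?oppr0 //; first exact: Gamma_opp.
  by rewrite tr2N; rewrite ltr0_norm in trM.
have dM := Gamma_det2 hM.
have qV := qfV _ dM; have hV := GammaV hM; have iV := det2_inv dM.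
have e : M 1 0 * (z + z') = M 0 0 - M 1 1.
  apply: (mulfI (_ : z - z' != 0)); first by rewrite subr_eq0 gt_eqF // (lt_trans z'0).
  by rewrite /qf in fz fz'; lra.
have bE : M 0 1 = M 1 0 * (z * - z').
  have ez : z * (M 1 0 * (z + z')) = z * (M 0 0 - M 1 1) by rewrite e.
  by rewrite /qf in fz fz'; lra.
have zz : 0 < z * - z' by rewrite mulr_gt0 // oppr_gt0.
have c0 : M 1 0 != 0.
  apply: two_roots_neq0 fz fz' _ => //; first by rewrite gtr0_norm //; lra.
  by rewrite lt_eqF // (lt_trans z'0).
rewrite /det2 tr2E in dM trM.
have bc : 0 < M 0 1 * M 1 0.
  rewrite bE mulrAC mulr_gt0 // -expr2 lt_neqAle sqr_ge0 andbT eq_sym.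
  by rewrite expf_neq0.
have a0 : 0 < M 0 0 by nra.
have d0 : 0 < M 1 1 by nra.
case: (ltP 0 (M 1 0)) => h.
  by exists M; split=> //; split=> //; rewrite bE mulr_gt0.
have {c0}h : M 1 0 < 0 by rewrite lt_neqAle c0.
exists M^-1; split; rewrite ?qV ?fz ?fz' ?oppr0 //.
rewrite iV /posmx !mx2E; split=> //; rewrite oppr_gt0 //.
by rewrite bE pmulr_llt0.
Qed.

Lemma prim_words_eq x w : x != [::] -> w != [::] -> x ++ w = w ++ x ->
  ~ is_power p (wprod x) -> ~ is_power p (wprod w) -> x = w.
Proof.
move=> x0 w0 /comm_words [u [a [b [xE wE]]]] px pw.
have pow1 (y : seq nat) k : y != [::] -> y = flatten (nseq k u) ->
    ~ is_power p (wprod y) -> k = 1%N.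
  case: k => [|[|k]] // y0 yE []; first by rewrite yE in y0.
  exists (wprod u), k.+2; split=> //; first exact: Gamma_wprod.
  by rewrite yE wprod_flatten_nseq.
by rewrite xE wE (pow1 _ _ x0 xE px) (pow1 _ _ w0 wE pw).
Qed.

(** * Conjugacy classes and forms *)

Lemma conj_exp A M k : A \is a GRing.unit -> (A * M * A^-1) ^+ k = A * M ^+ k * A^-1.
Proof.
move=> uA; elim: k => [|k IH]; first by rewrite !expr0 mulr1 mulrV.
by rewrite exprS IH exprS !mulrA divrK.
Qed.

Lemma prim_hyp_pm M N : pm M N -> prim_hyp p M -> prim_hyp p N.
Proof.
move=> h [[hM tr] np]; split.
  split; first exact: Gamma_pm hM.
  by case: h => ->; rewrite ?tr2N ?normrN.
move=> [B [k [hB k2 e]]]; apply: np; exists B, k; split=> //.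
by rewrite -e; apply/pmP/pm_sym.
Qed.

Lemma prim_hyp_conj A M : Gamma A -> prim_hyp p M -> prim_hyp p (A * M * A^-1).
Proof.
move=> hA [[hM tr] np]; have uA := Gamma_unit hA; split.
  split; last by rewrite tr2_conj // (Gamma_det2 hA).
  by apply: GammaM; [apply: GammaM | apply: GammaV].
move=> [B [k [hB k2 /pmP e]]]; apply: np; exists (A^-1 * B * A^-1^-1), k; split=> //.
  by rewrite invrK; apply: GammaM => //; apply: GammaM => //; apply: GammaV.
rewrite conj_exp ?unitrV // invrK; apply/pmP.
have -> : M = A^-1 * (A * M * A^-1) * A by rewrite !mulrA mulVr // mul1r divrK.
by case: e => ->; [left | right]; rewrite ?mulrN ?mulNr.
Qed.

Lemma prim_hyp_gt2 M : prim_hyp p M -> 0 < \tr M -> 2 < \tr M.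
Proof. by move=> [[_ h] _] t; rewrite gtr0_norm in h. Qed.

Lemma prim_hyp_Gamma M : prim_hyp p M -> Gamma M.
Proof. by case=> -[]. Qed.

(** Conjugation preserves the trace, so positive traces settle the sign. *)
Lemma class_mem M N : prim_hyp p M -> 0 < \tr M -> 0 < \tr N ->
  conj_class p M (pm N) <-> exists2 A, Gamma A & N = A * M * A^-1.
Proof.
move=> pM tM tN; split=> -[A hA e]; exists A => //; last by rewrite e.
case/pmP: e => // e; exfalso; move: tN.
by rewrite e tr2N tr2_conj ?(Gamma_det2 hA) // oppr_gt0 ltNge ltW.
Qed.

Lemma class_rep (C : set (set 'M[R]_2)) : prim_hyp_class p C ->
  exists M, [/\ prim_hyp p M, 0 < \tr M & C = conj_class p M].
Proof.
move=> [M pM ->]; have [[hM tr] _] := pM.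
case: (ltP 0 (\tr M)) => h; first by exists M.
exists (- M); split.
- by apply: prim_hyp_pm pM; right.
- by rewrite tr2N oppr_gt0; rewrite ler0_norm // in tr; lra.
- apply/seteqP; split=> x [A hA ->]; exists A => //; apply/pmP;
    rewrite mulrN mulNr ?opprK; by right.
Qed.

Lemma conj_class_conj A M : Gamma A -> conj_class p (A * M * A^-1) = conj_class p M.
Proof.
move=> hA; have uA := Gamma_unit hA; apply/seteqP; split=> x [B hB ->].
  exists (B * A); first exact: GammaM.
  by rewrite invrM ?(Gamma_unit hB) // !mulrA.
exists (B * A^-1); first by apply: GammaM => //; apply: GammaV.
rewrite invrM ?unitrV ?(Gamma_unit hB) // invrK; congr pm.
by rewrite !mulrA !divrK.
Qed.

Lemma Qmx_conj M A : det2 A = 1 -> bqf_act (Qmx M) A = Qmx (A^-1 * M * A).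
Proof.
move=> dA; rewrite det2_inv // /bqf_act /Qmx /=.
by congr Bqf; rewrite !mulmx2E !mx2E; ring.
Qed.

(** The form gives b, c and d - a; then (a + d)^2 = (d - a)^2 + 4 (1 + b c) gives the trace up to
    sign. *)
Lemma Qmx_inj M N : det2 M = 1 -> det2 N = 1 -> 0 < \tr M -> 0 < \tr N ->
  Qmx M = Qmx N -> M = N.
Proof.
rewrite /det2 !tr2E => dM dN tM tN [ec ed eb].
have eb' : M 0 1 = N 0 1 by lra.
have et : M 0 0 + M 1 1 = N 0 0 + N 1 1.
  have : (M 0 0 + M 1 1) ^+ 2 = (N 0 0 + N 1 1) ^+ 2.
    transitivity ((M 1 1 - M 0 0) ^+ 2 + 4 * (M 0 0 * M 1 1)); first by ring.
    have -> : M 0 0 * M 1 1 = N 0 0 * N 1 1 by rewrite ec eb' in dM; lra.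
    by rewrite ed; ring.
  by move/eqP; rewrite eqrXn2 ?ltW // => /eqP.
by apply: mx2P => //; lra.
Qed.

(** Substitution in the form is conjugation of the matrix, and the conjugates have entries in
    Z[lambda], so [lambda_bqf] holds automatically. *)
Lemma bqf_classE M Q : Gamma M ->
  bqf_class p (Qmx M) Q <-> exists2 A, Gamma A & Q = Qmx (A * M * A^-1).
Proof.
move=> hM; split=> [[_ [A hA ->]]|[A hA ->]].
  by exists A^-1; [apply: GammaV | rewrite invrK Qmx_conj //; apply: Gamma_det2 hA].
have hN : Gamma (A * M * A^-1).
  by apply: GammaM; [apply: GammaM | apply: GammaV].
split.
  have [a b c d] := Gamma_Zlam hN; split=> //=; last exact: in_ZlamN.
  by apply: in_ZlamD => //; apply: in_ZlamN.
exists A^-1; first exact: GammaV.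
by rewrite Qmx_conj ?invrK //; apply/det2V/(Gamma_det2 hA).
Qed.

Lemma forms_ofE M N : prim_hyp p M -> 0 < \tr M -> conj_class p M (pm N) ->
  0 < \tr N -> forms_of p (conj_class p M) = bqf_class p (Qmx N).
Proof.
move=> pM tM CN tN; have [A hA NE] := (class_mem pM tM tN).1 CN.
have hM := prim_hyp_Gamma pM.
have hN : Gamma N by rewrite NE; apply: GammaM; [apply: GammaM | apply: GammaV].
apply/seteqP; split=> Q.
  move=> [N1 [CN1 tN1]]; have [B hB N1E] := (class_mem pM tM tN1).1 CN1.
  have uA := Gamma_unit hA; have uB := Gamma_unit hB.
  have hN1 : Gamma N1 by rewrite N1E; apply: GammaM; [apply: GammaM | apply: GammaV].
  move=> /(bqf_classE _ hN1) [D hD ->]; apply/(bqf_classE _ hN).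
  have uD := Gamma_unit hD.
  exists (D * B * A^-1).
    by apply: GammaM; [apply: GammaM | apply: GammaV].
  have -> : (D * B * A^-1)^-1 = A * (B^-1 * D^-1).
    by rewrite invrM ?unitrV ?(Gamma_unit (GammaM hD hB)) // invrK invrM.
  rewrite NE N1E; congr Qmx.
  by rewrite !mulrA !divrK.
by move=> h; exists N.
Qed.

Lemma conj_class_id M : conj_class p M (pm M).
Proof. by exists 1; [apply: Gamma1 | rewrite mul1r invr1 mulr1]. Qed.

Lemma attracting_posmx N z : Gamma N -> 2 < \tr N -> posmx N ->
  attracting N z <-> z = alpha_mx N.
Proof.
move=> hN tN [_ _ c0 _]; apply: attractingE; last by rewrite gt_eqF.
- exact: (Gamma_det2 hN).
- by rewrite -tr2E.
Qed.

Lemma ZsetE M z : prim_hyp p M -> 0 < \tr M ->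
  Zset p (bqf_class p (Qmx M)) z <->
  exists A, [/\ Gamma A, posmx (A * M * A^-1) & z = alpha_mx (A * M * A^-1)].
Proof.
move=> pM tM; have hM := prim_hyp_Gamma pM.
have conjP A : Gamma A -> [/\ prim_hyp p (A * M * A^-1), 0 < \tr (A * M * A^-1)
    & det2 (A * M * A^-1) = 1].
  move=> hA; have pN := prim_hyp_conj hA pM; split=> //.
    by rewrite tr2_conj // (Gamma_det2 hA).
  exact: Gamma_det2 (prim_hyp_Gamma pN).
split=> [[[_ sz]]|].
  move=> /(bqf_classE _ hM) [A hA]; have [pN tN dN] := conjP A hA.
  rewrite /Qnum /prim_mx.
  case: xgetP => [N0 _ [pN0 tN0 atN0]|none QE]; last first.
    (* The default of [prim_mx] is the zero matrix, whose form would force c = 0 and a = d,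
       impossible with determinant 1 and trace above 2. *)
    exfalso; have tN2 := prim_hyp_gt2 pN tN.
    move: (A * M * A^-1) QE dN tN2 => N.
    rewrite /Qmx !mxE /det2 tr2E => -[<- e2 e3].
    by have -> : N 1 1 = N 0 0; [lra | nra].
  move=> QE.
  have NE : N0 = A * M * A^-1.
    by apply: Qmx_inj QE => //; apply: Gamma_det2 (prim_hyp_Gamma pN0).
  exists A; rewrite -NE; have hN0 := prim_hyp_Gamma pN0.
  have dN0 := Gamma_det2 hN0; have t2 := prim_hyp_gt2 pN0 tN0.
  have fz : qf N0 z = 0 by case: atN0 => /(fixesP _ dN0).
  (* The default 0 of [hecke_conj] is not negative, so z' really is a second fixed point of a
     hyperbolic M'. A positive matrix with the same fixed points then forces [N0] to fix z' too. *)
  move: sz; rewrite /hecke_conj; case: xgetP => [z' _ |]; last first.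
    by move=> _; rewrite ltxx.
  move=> [zz' [M' [[hM' tM'] fM fM']]] /andP[z'0 z0].
  have dM' := Gamma_det2 hM'.
  have qz := (fixesP _ dM').1 fM; have qz' := (fixesP _ dM').1 fM'.
  have z'z : z' < 0 < z by rewrite z'0 z0.
  have [W [hW pW fW fW']] := opposite_roots_posmx hM' tM' z'z qz qz'.
  have fN' := posmx_share hW pW z0 fW fW' hN0 fz.
  have c0 : N0 1 0 != 0.
    by apply: two_roots_neq0 fz fN' zz' => //; rewrite gtr0_norm.
  have zE : z = alpha_mx N0 by apply/attractingE; rewrite // -tr2E.
  split=> //; apply: (@posmx_of_roots _ _ z') => //; by rewrite -zE.
move=> [A [hA pN zE]]; have [prN tN dN] := conjP A hA.
set N := A * M * A^-1 in pN zE prN tN dN.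
have t2 := prim_hyp_gt2 prN tN; have hN := prim_hyp_Gamma prN.
have [_ _ c0 _] := pN.
have [fz fz' ltz] := alpha_roots dN t2 c0; have /andP[z'0 z0] := posmx_roots dN t2 pN.
rewrite -zE in fz ltz z0; set z' := conj_root N in fz' ltz z'0.
have fixz := (fixesP z dN).2 fz; have fixz' := (fixesP z' dN).2 fz'.
have hyN : hyperbolic p N by case: prN.
have share B : Gamma B -> qf B z = 0 -> qf B z' = 0.
  exact: posmx_share hN pN z0 fz fz'.
have hz' : hecke_conj p z < 0.
  (* Whichever element the choice uses, it also fixes z', and a quadratic has no third root. *)
  rewrite /hecke_conj; case: xgetP => [y _ [yz [B [[hB tB] Bz By]]]|]; last first.
    move=> /(_ z') []; split; first by rewrite lt_eqF.
    by exists N.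
  have dB := Gamma_det2 hB.
  have qz := (fixesP _ dB).1 Bz; have qy := (fixesP _ dB).1 By.
  have qz' := share B hB qz.
  have cB : B 1 0 != 0 by apply: two_roots_neq0 qz qz' _; rewrite ?lt_eqF.
  by rewrite (qf_uniq cB qz qz' qy) // lt_eqF.
split; first by split; [exists N | rewrite hz' z0].
rewrite /Qnum /prim_mx; case: xgetP => [N0 _ [pN0 tN0 atN0]|]; last first.
  by move=> /(_ N) []; split=> //; apply/attracting_posmx.
have hN0 := prim_hyp_Gamma pN0.
have dN0 := Gamma_det2 hN0; have t20 := prim_hyp_gt2 pN0 tN0.
have fz0 : qf N0 z = 0 by case: atN0 => /(fixesP _ dN0).
have fz0' := share N0 hN0 fz0.
have c00 : N0 1 0 != 0.
  by apply: two_roots_neq0 fz0 fz0' _; rewrite ?gtr0_norm ?lt_eqF.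
have zE0 : z = alpha_mx N0 by apply/attractingE; rewrite // -tr2E.
have pos0 : posmx N0 by apply: (@posmx_of_roots _ _ z') => //; rewrite -zE0.
have [n ln nE] := posmx_wprod hN pN; have [n0 ln0 n0E] := posmx_wprod hN0 pos0.
have nnil (B : 'M[R]_2) (y : seq nat) : B = wprod y -> posmx B -> y != [::].
  move=> BE [_ b _ _]; apply/eqP=> y0; move: b.
  by rewrite BE y0 wprod_nil mx2_1 !mx2E ltxx.
(* Both candidates for the primitive matrix of z are positive, hence primitive words fixing z; these
   commute and therefore coincide. *)
apply/(bqf_classE _ hM); exists A => //; rewrite -/N; congr Qmx; rewrite nE n0E.
congr wprod; symmetry; apply: prim_words_eq.
- exact: nnil nE pN.
- exact: nnil n0E pos0.
- by apply: (@fix_comm_words _ _ z); rewrite // -?nE -?n0E.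
- by rewrite -nE; case: prN.
- by rewrite -n0E; case: pN0.
Qed.

End FixedPoints.

(** * Conjugate words *)

Section ConjugateWords.
Variables (R : realType) (p : nat).
Hypothesis hp : (3 <= p)%N.
Local Notation T := (Tmx R).
Local Notation V := (Vmx R p).
Local Notation Gamma := (@Gamma R p).
Local Notation wprod := (wprod R p).
Local Notation letter := (letter p).
Implicit Types (M N A B : 'M[R]_2) (v w x y : seq nat) (z : R).

(** Some off-diagonal entry of the first generator is at least 1, and the remaining factor cannot
    cancel it. *)
Lemma wprod_neq1 j w : letter j -> all letter w -> wprod (j :: w) <> 1.
Proof.
case: j => // j /andP[_ jp] lw; have [a b c d] := nonneg_diag1_wprod R hp lw.
rewrite wprod_cons VmxE // mx2_1 => e.
have := congr1 (fun A : 'M[R]_2 => A 0 1) e.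
have := congr1 (fun A : 'M[R]_2 => A 1 0) e.
rewrite /= !mulmx2E !mx2E => e10 e01.
have s1 : 1 <= hsin R p j.+1 by apply: hsin_ge1.
case: (eqVneq j 0%N) => [j0|j0].
  have s2 : 1 <= hsin R p j.+2 by apply: hsin_ge1 => //; lia.
  by nra.
have s0 : 1 <= hsin R p j by apply: hsin_ge1 => //; lia.
by nra.
Qed.

Lemma wprod_free v w : all letter v -> all letter w -> wprod v = wprod w -> v = w.
Proof.
elim: v w => [|i v IH] [|j w] //=.
- by move=> _ /andP[lj lw]; rewrite wprod_nil => /esym /(wprod_neq1 lj lw).
- by move=> /andP[li lv] _; rewrite wprod_nil => /(wprod_neq1 li lv).
move=> /andP[li lv] /andP[lj lw] e.
have ij : i = j.
  have pv y : all letter y -> posv (act (wprod y) (1, 1)).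
    move=> ly; apply: posv_act; first exact: nonneg_diag1_wprod.
    by split=> /=; lra.
  apply: (pingpong hp li lj (pv v lv) (pv w lw)).
  by rewrite -!actM -!wprod_cons e.
congr cons => //; apply: IH => //; move: e; rewrite !wprod_cons ij.
by apply: mulrI; apply/det2_unit/det2_V.
Qed.

(** Absorbing A into a power of v gives a matrix T^e b intertwining v and its conjugate. For e = 0
    this is the word equation n b = b v; for e = 1 the traces would differ. *)
Lemma conj_wprod_split A v : all letter v -> 2 < \tr (wprod v) -> Gamma A ->
  posmx (A * wprod v * A^-1) ->
  exists x y, v = x ++ y /\ A * wprod v * A^-1 = wprod (y ++ x).
Proof.
move=> lv tv hA; set W := wprod v; set N := A * W * A^-1 => pN.
have dW : det2 W = 1 by apply: det2_wprod.
have pW : posmx W by apply: wprod_posmx => //; rewrite gtr0_norm //; lra.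
have hN : Gamma N.
  by apply: GammaM; [apply: GammaM => //; apply: Gamma_wprod | apply: GammaV].
have [n ln NE] := posmx_wprod hp hN pN.
have v0 : v != [::].
  apply/eqP=> e; move: tv; rewrite e wprod_nil mx2_1 tr2E !mx2E; lra.
have [k [e [b [lb h]]]] := Gamma_absorb hp hA lv v0.
have com : T ^+ e * wprod b * W = N * (T ^+ e * wprod b).
  have c : A * W ^+ k * W = N * (A * W ^+ k).
    by rewrite /N -!mulrA (mulKr (Gamma_unit hA)) -exprSr exprS.
  case: h => hE; rewrite hE in c; first by rewrite c.
  by rewrite mulrN mulNr in c; apply: oppr_inj.
case: e {h} com => [com|]; last first.
  rewrite expr0 mul1r NE -!wprod_cat => com.
  have [||x [y [vE nE]]] := conj_words (esym (wprod_free _ _ com)).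
  - by rewrite all_cat lb lv.
  - by rewrite all_cat ln lb.
  - by exists x, y; rewrite vE nE.
(* With b (z, 1) = (x, y) positive, N has the eigenvector (-y, x) for the eigenvalue mu of W at (z,
   1). Its mixed signs push both diagonal entries of N above mu, while those of W lie below mu. *)
exfalso; have [a0 b0 c0 d0] := pN; have [a0' b0' c0' d0'] := pW.
have [fz _ _] := alpha_roots dW tv c0'; have /andP[_ z0] := posmx_roots dW tv pW.
set z := alpha_mx W in fz z0; set mu := W 1 0 * z + W 1 1.
have Wz : act W (1 * z, 1) = (1 * mu * z, 1 * mu) by apply: qf_act.
have trN : \tr N = \tr W by apply/tr2_conj/(Gamma_det2 hA).
clearbody N; have pv : posv (act (wprod b) (1 * z, 1)).
  by apply: posv_act; [apply: nonneg_diag1_wprod | split=> /=; lra].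
have := congr1 (fun B => act B (1 * z, 1)) com; rewrite expr1 /= 2!actM Wz !actM.
move: pv; have -> : act (wprod b) (1 * mu * z, 1 * mu) =
    (mu * (act (wprod b) (1 * z, 1)).1, mu * (act (wprod b) (1 * z, 1)).2).
  by rewrite /act /=; congr (_, _); ring.
case: (act (wprod b) (1 * z, 1)) => x y [/= x0 y0].
rewrite /act !mx2E /= => -[e1 e2].
have muz : mu * z = W 0 0 * z + W 0 1 by rewrite /mu; rewrite /qf in fz; lra.
have m1 : W 1 1 < mu by rewrite /mu ltrDr mulr_gt0.
have m2 : W 0 0 < mu by rewrite -(ltr_pM2r z0) muz ltrDl.
clearbody mu.
have n1 : mu < N 0 0.
  rewrite -(ltr_pM2r y0); have := mulr_gt0 b0 x0; lra.
have n2 : mu < N 1 1.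
  rewrite -(ltr_pM2r x0); have := mulr_gt0 c0 y0; lra.
by move: trN; rewrite !tr2E; lra.
Qed.

End ConjugateWords.

(** * Continued fractions *)

Section ContinuedFractions.
Variables (R : realType) (p : nat).
Hypothesis hp : (3 <= p)%N.
Local Notation S := (Smx R p).
Local Notation V := (Vmx R p).
Local Notation Gamma := (@Gamma R p).
Local Notation lambda := (lam R p).
Local Notation wprod := (wprod R p).
Local Notation letter := (letter p).
Local Notation gen_prod := (gen_prod R p).
Implicit Types (M N A B : 'M[R]_2) (z zeta : R).

Let lambda_gt0 : 0 < lambda.
Proof. by have := lam_ge1 R hp; lra. Qed.

Lemma mobiusM M N x : N 1 0 * x + N 1 1 != 0 ->
  mobius (M * N) x = mobius M (mobius N x).
Proof.
move=> e0; rewrite /mobius !mulmx2E; set e := _ + N 1 1 in e0 *.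
set y := (N 0 0 * x + N 0 1) / e.
have -> : (M 0 0 * N 0 0 + M 0 1 * N 1 0) * x + (M 0 0 * N 0 1 + M 0 1 * N 1 1) =
    e * (M 0 0 * y + M 0 1) by rewrite /y /e; field.
have -> : (M 1 0 * N 0 0 + M 1 1 * N 1 0) * x + (M 1 0 * N 0 1 + M 1 1 * N 1 1) =
    e * (M 1 0 * y + M 1 1) by rewrite /y /e; field.
by rewrite -mulf_div divff // mul1r.
Qed.

Lemma nonneg_den_gt0 M x : nonneg_diag1 M -> 0 <= x -> 0 < M 1 0 * x + M 1 1.
Proof. by move=> [a b c d] x0; have := mulr_ge0 c x0; lra. Qed.

Lemma nonneg_mobiusM M N x : nonneg_diag1 N -> 0 <= x ->
  mobius (M * N) x = mobius M (mobius N x).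
Proof. by move=> hN x0; rewrite mobiusM // gt_eqF // nonneg_den_gt0. Qed.

Lemma nonneg_mobius_ge0 M x : nonneg_diag1 M -> 0 <= x -> 0 <= mobius M x.
Proof.
move=> hM x0; have h := nonneg_den_gt0 hM x0; have [a b c d] := hM.
by rewrite divr_ge0 ?(ltW h) // addr_ge0 // mulr_ge0 //; lra.
Qed.

Lemma nonneg_mobius_gt0 M x : nonneg_diag1 M -> 0 < x -> 0 < mobius M x.
Proof.
move=> hM x0; have h := nonneg_den_gt0 hM (ltW x0); have [a b c d] := hM.
by rewrite divr_gt0 // ltr_wpDr // mulr_gt0 //; lra.
Qed.

Lemma mobius_SX n x : mobius (S ^+ n) x = x + n%:R * lambda.
Proof. by rewrite SmxX /mobius !mx2E mul0r add0r divr1 mul1r. Qed.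

Lemma mobius1 x : mobius (1 : 'M[R]_2) x = x.
Proof. by rewrite mx2_1 /mobius !mx2E mul0r add0r divr1 mul1r addr0. Qed.

Lemma mobius_SXV n x : mobius (S ^- n) x = x - n%:R * lambda.
Proof.
have h : S ^- n = mx2 1 (- (n%:R * lambda)) 0 1.
  rewrite det2_inv; last exact/det2X/det2_S.
  by rewrite /adj2 SmxX !mx2E oppr0.
by rewrite h /mobius !mx2E mul0r add0r invr1; ring.
Qed.

Local Notation vz k zeta := (mobius (V k) zeta).

Lemma vz1 zeta : vz 1 zeta = zeta + lambda.
Proof. by rewrite Vmx1 -[Smx R p]expr1 mobius_SX mul1r. Qed.

Lemma vz_gt0 k zeta : (0 < k < p.-1)%N -> 0 <= zeta -> 0 < vz k zeta.
Proof.
case: k => // k /= h z0; have lk : letter k.+1 by rewrite /letter; lia.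
have nk := nonneg_diag1_V R hp lk.
have d := nonneg_den_gt0 nk z0; rewrite /mobius divr_gt0 //.
rewrite VmxE // !mx2E.
have s1 : 1 <= hsin R p k.+1 by apply: hsin_ge1 => //; lia.
have s2 : 1 <= hsin R p k.+2 by apply: hsin_ge1 => //; lia.
by nra.
Qed.

Lemma vzS k zeta : (0 < k < p.-1)%N -> 0 <= zeta ->
  vz k.+1 zeta = lambda - (vz k zeta)^-1.
Proof.
move=> h z0; have lk : letter k by rewrite /letter; lia.
rewrite -UV; last by lia.
rewrite nonneg_mobiusM //; last exact: nonneg_diag1_V.
have := vz_gt0 h z0; move: (vz k zeta) => v v0.
rewrite UmxE /mobius !mx2E; field.
by rewrite gt_eqF //= mul1r addr0 gt_eqF.
Qed.

(** * Finite segments of a continued fraction *)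

Lemma lcf_tailD z m n : lcf_tail p z (m + n) = lcf_tail p (lcf_tail p z m) n.
Proof. by elim: n => [|n IH]; rewrite ?addn0 // addnS /= IH. Qed.

Lemma lcf_digitD z m n : lcf_digit p z (m + n) = lcf_digit p (lcf_tail p z m) n.
Proof. by rewrite /lcf_digit lcf_tailD. Qed.

Local Arguments lcf_tail : simpl never.

(** Segments as a relation between a number and its tail: they concatenate and split, and a nonempty
    one from z to itself means pure periodicity. *)
Fixpoint follows z (s : seq nat) z' : Prop :=
  if s is r :: s' then lcf_digit p z 0 = r%:Z /\ follows (lcf_tail p z 1) s' z'
  else z = z'.

Lemma followsP z s z' : follows z s z' <-> lcf_tail p z (size s) = z' /\
  forall i, (i < size s)%N -> lcf_digit p z i = (nth 0%N s i)%:Z.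
Proof.
elim: s z => [|r s IH] z; first by split=> [->|[]].
rewrite [follows _ _ _]/= [size _]/= -(add1n (size s)) lcf_tailD; split.
  move=> [d /IH [t h]]; split=> // -[|i] // hi.
  by rewrite -(add1n i) lcf_digitD h.
move=> [t h]; split; first exact: (h 0%N).
by apply/IH; split=> // i hi; rewrite -lcf_digitD h.
Qed.

Lemma follows_cat z z' z'' s s' :
  follows z s z' -> follows z' s' z'' -> follows z (s ++ s') z''.
Proof. by elim: s z => [|r s IH] z /= => [->|[d h] /(IH _ h)]. Qed.

Lemma follows_split z z'' s s' : follows z (s ++ s') z'' ->
  exists2 z', follows z s z' & follows z' s' z''.
Proof.
elim: s z => [|r s IH] z /=; first by exists z.
by move=> [d /IH [z' h h']]; exists z'.
Qed.

Lemma digit_bounds z r : lcf_digit p z 0 = r ->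
  (r - 1)%:~R * lambda <= z < r%:~R * lambda.
Proof.
rewrite /lcf_digit /lcf_tail => rE.
have -> : r - 1 = Num.floor (z / lambda) by rewrite -rE addrK.
rewrite -ler_pdivlMr // ge_floor /= -ltr_pdivrMr // -rE.
exact: floorD1_gt.
Qed.

Lemma digitE z (r : nat) : r%:R * lambda <= z < r.+1%:R * lambda ->
  lcf_digit p z 0 = r.+1%:Z.
Proof.
move=> /andP[lo hi]; rewrite /lcf_digit /lcf_tail.
have -> : Num.floor (z / lambda) = r%:Z.
  apply: floor_def; rewrite ler_pdivlMr // ltr_pdivrMr //.
  by rewrite -natr1 in hi; rewrite intrD /= -!pmulrn; apply/andP.
by rewrite -addn1 PoszD.
Qed.

Lemma lcf_tail1 z (r : nat) : lcf_digit p z 0 = r%:Z ->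
  lcf_tail p z 1 = (r%:R * lambda - z)^-1.
Proof. by rewrite /lcf_digit /lcf_tail => ->. Qed.

(** The value lambda - 1 / V_k(zeta) lies strictly between 0 and lambda, so the digit is n + 1 and
    the next tail is V_k(zeta). *)
Lemma follows_step n k zeta : (0 < k < p.-1)%N -> 0 <= zeta ->
  0 < vz k.+1 zeta -> lcf_digit p (n%:R * lambda + vz k.+1 zeta) 0 = n.+1%:Z /\
  lcf_tail p (n%:R * lambda + vz k.+1 zeta) 1 = vz k zeta.
Proof.
move=> hk z0 v0; have w0 := vz_gt0 hk z0; have e := vzS hk z0.
have lt : vz k.+1 zeta < lambda by rewrite e ltrBlDr ltrDl invr_gt0.
have d : lcf_digit p (n%:R * lambda + vz k.+1 zeta) 0 = n.+1%:Z.
  by apply: digitE; rewrite -natr1; apply/andP; split; lra.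
split=> //; rewrite (lcf_tail1 d) -natr1 e -[RHS]invrK; congr (_^-1); ring.
Qed.

(** Each digit 1 lowers the index of the generator by one, down to V_1(zeta) = zeta + lambda. *)
Lemma follows_ones k zeta : (k.+1 < p)%N -> 0 < zeta ->
  follows (vz k.+1 zeta) (nseq k 1%N) (zeta + lambda).
Proof.
move=> + z0; elim: k => [_|k IH hk] /=; first exact: vz1.
have v0 : 0 < vz k.+2 zeta.
  by apply: nonneg_mobius_gt0 => //; apply: nonneg_diag1_V => //; rewrite /letter; lia.
have [|d t] := @follows_step 0 k.+1 zeta _ (ltW z0) v0; first by lia.
rewrite mul0r add0r in d t; split=> //; rewrite t.
by apply: IH; lia.
Qed.

(** The starting number is (m + 1) lambda + V_j(zeta): its first digit is m + 2, and from V_(j-1)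
    there are j - 2 ones down to V_1. *)
Lemma follows_block m j zeta : (2 <= j <= p.-1)%N -> 0 < zeta ->
  follows (mobius (S ^+ m * V j) zeta + lambda) (m.+2 :: nseq (j - 2) 1%N)
    (zeta + lambda).
Proof.
move=> hj z0; have lj : letter j by rewrite /letter; lia.
rewrite nonneg_mobiusM ?(ltW z0) //; last exact: nonneg_diag1_V.
rewrite mobius_SX.
have -> : vz j zeta + m%:R * lambda + lambda = m.+1%:R * lambda + vz (j - 2).+2 zeta.
  by rewrite -natr1 (_ : (j - 2).+2 = j); [ring | lia].
have v0 : 0 < vz (j - 2).+2 zeta.
  by apply: nonneg_mobius_gt0 => //; apply: nonneg_diag1_V => //; rewrite /letter; lia.
have [|d t] := @follows_step m.+1 (j - 2).+1 zeta _ (ltW z0) v0; first by lia.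
split=> //; rewrite t; apply: follows_ones => //; lia.
Qed.

Definition gen_ok (w : seq (nat * nat)) := all (fun mj => (2 <= mj.2 <= p.-1)%N) w.

Definition gword (w : seq (nat * nat)) : seq nat :=
  flatten [seq rcons (nseq mj.1 1%N) mj.2 | mj <- w].

Lemma gen_prodE w : gen_prod w = wprod (gword w).
Proof.
rewrite /Defs.gen_prod; elim: w => [|[m j] w IH]; first by rewrite big_nil wprod_nil.
by rewrite big_cons IH wprod_cat wprod_rcons wprod_nseq.
Qed.

Lemma gen_prod_cons m j w : gen_prod ((m, j) :: w) = S ^+ m * V j * gen_prod w.
Proof. by rewrite /Defs.gen_prod big_cons Vmx1. Qed.

Lemma gword_letter w : gen_ok w -> all letter (gword w).
Proof.
elim: w => [|[m j] w IH] //= /andP[hj hw].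
rewrite all_cat IH // andbT all_rcons all_nseq /letter.
by rewrite /=; apply/andP; split; [|apply/orP; right]; lia.
Qed.

Lemma nonneg_gen w : gen_ok w -> nonneg_diag1 (gen_prod w).
Proof. by move=> h; rewrite gen_prodE; apply/nonneg_diag1_wprod/gword_letter. Qed.

Lemma follows_gen w zeta : gen_ok w -> 0 < zeta ->
  follows (mobius (gen_prod w) zeta + lambda) (cf_period w) (zeta + lambda).
Proof.
move=> + z0; elim: w => [_|[m j] w IH /= /andP[hj hw]].
  by rewrite /Defs.gen_prod big_nil mobius1.
have ng := nonneg_gen hw.
rewrite gen_prod_cons nonneg_mobiusM ?(ltW z0) //.
have /= [d h] := follows_block m hj (nonneg_mobius_gt0 ng z0).
rewrite /cf_period /=; split=> //.
by apply: follows_cat h _; apply: IH.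
Qed.

Lemma follows_periodic z s : (0 < size s)%N -> follows z s z -> lcf_purely_periodic p z s.
Proof.
move=> s0 /followsP [t h]; split=> // n.
have tq q : lcf_tail p z (q * size s) = z.
  by elim: q => // q IH; rewrite mulSn lcf_tailD t.
by rewrite {1}(divn_eq n (size s)) lcf_digitD tq h // ltn_mod.
Qed.

Lemma periodic_follows z s : lcf_purely_periodic p z s ->
  exists2 z', follows z s z' & lcf_purely_periodic p z' s.
Proof.
move=> [s0 h]; exists (lcf_tail p z (size s)).
  by apply/followsP; split=> // i hi; rewrite h modn_small.
by split=> // n; rewrite -lcf_digitD h modnDl.
Qed.

Lemma follows_step_inv z r : lcf_digit p z 0 = r%:Z ->
  0 < lcf_tail p z 1 /\ z = r%:R * lambda - (lcf_tail p z 1)^-1.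
Proof.
move=> d; have /andP[_ hi] := digit_bounds d; rewrite (lcf_tail1 d) invrK.
by rewrite invr_gt0 subr_gt0; split=> //; ring.
Qed.

Lemma follows_ones_inv k zeta z : (k.+1 < p)%N -> 0 <= zeta ->
  follows z (nseq k 1%N) (zeta + lambda) -> z = vz k.+1 zeta.
Proof.
move=> + z0; elim: k z => [|k IH] z hk /=; first by rewrite vz1.
move=> [d /IH h]; have [_ ->] := follows_step_inv d.
rewrite h; last by lia.
by rewrite (@vzS k.+1) ?mul1r //; lia.
Qed.

(** Every step inverts to z = r lambda - 1 / tail, so digits and final tail determine z. *)
Lemma follows_gen_inv w zeta z : gen_ok w -> 0 <= zeta ->
  follows z (cf_period w) (zeta + lambda) -> z = mobius (gen_prod w) zeta + lambda.
Proof.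
move=> + z0; elim: w z => [|[m j] w IH] z /=.
  by move=> _ ->; rewrite /Defs.gen_prod big_nil mobius1.
move=> /andP[hj hw]; have ng := nonneg_gen hw.
rewrite /cf_period [flatten _]/= => -[d] /follows_split [z' h /(IH _ hw) z'E].
have lj : letter j by rewrite /letter; lia.
have g0 := nonneg_mobius_ge0 ng z0.
rewrite gen_prod_cons nonneg_mobiusM // nonneg_mobiusM //; last exact: nonneg_diag1_V.
rewrite z'E in h.
have {}h := follows_ones_inv _ g0 h.
have [_ ->] := follows_step_inv d; rewrite h; last by lia.
rewrite mobius_SX; set G := mobius (gen_prod w) zeta.
have -> : vz j G = lambda - (vz (j - 2).+1 G)^-1.
  by rewrite -vzS //; [congr (vz _ _); lia | lia].
by rewrite -natr1 -natr1; ring.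
Qed.

(** * Uniqueness of the number with a given period *)

Lemma nonneg_contract M x y : nonneg_diag1 M -> det2 M = 1 -> 0 <= x -> 0 <= y ->
  M 1 0 * `|mobius M x - mobius M y| <= 1.
Proof.
move=> hM dM x0 y0; have hx := nonneg_den_gt0 hM x0; have hy := nonneg_den_gt0 hM y0.
have [a b c d] := hM.
have -> : mobius M x - mobius M y =
    (x - y) / ((M 1 0 * x + M 1 1) * (M 1 0 * y + M 1 1)).
  rewrite -[x - y]mul1r -dM /mobius /det2; field.
  by rewrite !gt_eqF.
have h := mulr_gt0 hx hy.
rewrite normrM normfV (gtr0_norm h) mulrA ler_pdivrMr // mul1r.
(* It remains to see c |x - y| <= c (x + y) <= (c x + d) (c y + d), as d >= 1. *)
have n : `|x - y| <= x + y by rewrite ler_norml; apply/andP; split; lra.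
have cx := mulr_ge0 c x0; have cy := mulr_ge0 c y0.
have := ler_wpM2l c n; have := mulr_ge0 cx cy.
by nra.
Qed.

Lemma nonneg_diag1X M n : nonneg_diag1 M -> nonneg_diag1 (M ^+ n).
Proof.
move=> h; elim: n => [|n IH]; last by rewrite exprS; apply: nonneg_diag1M.
by rewrite expr0 mx2_1 /nonneg_diag1 !mx2E; split; lra.
Qed.

Lemma nonneg_pow_ge M n : nonneg_diag1 M -> n%:R * M 1 0 <= (M ^+ n) 1 0.
Proof.
move=> h; elim: n => [|n IH]; first by rewrite expr0 mx2_1 !mx2E mul0r.
have [a b c d] := h; have [a' b' c' d'] := nonneg_diag1X n h.
by rewrite exprS mulmx2E -natr1; nra.
Qed.

(** The lower left entry of M^n grows at least linearly, so the image of the half-line under M^n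
    shrinks to zeta; the Archimedean property concludes. *)
Lemma contract_unique M x zeta : nonneg_diag1 M -> det2 M = 1 -> 0 < M 1 0 ->
  0 <= zeta -> mobius M zeta = zeta ->
  (forall n, exists2 y, 0 <= y & x = mobius (M ^+ n) y) -> x = zeta.
Proof.
move=> h dM c0 z0 fz hx.
have fzn n : mobius (M ^+ n) zeta = zeta.
  elim: n => [|n IH]; last by rewrite exprS nonneg_mobiusM ?IH //; apply: nonneg_diag1X.
  by rewrite expr0 mobius1.
apply/eqP/negPn/negP; rewrite -subr_eq0 -normr_gt0 => e0.
have bound n : n%:R * (M 1 0 * `|x - zeta|) <= 1.
  have [y y0 xE] := hx n.
  have := nonneg_contract (nonneg_diag1X n h) (det2X n dM) y0 z0.
  rewrite -xE fzn mulrA; apply: le_trans.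
  by rewrite ler_wpM2r // nonneg_pow_ge.
have k0 : 0 < M 1 0 * `|x - zeta| by rewrite mulr_gt0.
have := bound (Num.bound (M 1 0 * `|x - zeta|)^-1).
have := @archi_boundP _ (M 1 0 * `|x - zeta|)^-1.
rewrite invr_ge0 (ltW k0) => /(_ isT); rewrite -(ltr_pM2r k0) mulVf ?gt_eqF //.
by move=> ??; lra.
Qed.

Lemma posmx_mobius_alpha M : det2 M = 1 -> 2 < \tr M -> posmx M ->
  mobius M (alpha_mx M) = alpha_mx M.
Proof.
move=> dM tM pM; have [_ _ c0 _] := pM; have [f _ _] := alpha_roots dM tM c0.
by have [_] := (fixesP _ dM).2 f.
Qed.

Lemma periodic_gen w z : gen_word p w -> 2 < \tr (gen_prod w) ->
  posmx (gen_prod w) ->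
  lcf_purely_periodic p z (cf_period w) <-> z = alpha_mx (gen_prod w) + lambda.
Proof.
move=> [w0 okw] tG pG; have nG := nonneg_gen okw.
have dG : det2 (gen_prod w) = 1 by rewrite gen_prodE det2_wprod.
have fG := posmx_mobius_alpha dG tG pG.
have /andP[_ a0] := posmx_roots dG tG pG; have [_ _ c0 _] := pG.
have s0 : (0 < size (cf_period w))%N by case: (w) w0.
split=> [per|->]; last first.
  by apply: follows_periodic => //; rewrite -{1}fG; apply: follows_gen.
(* The first digit m + 2 is at least 2, so y >= (m + 1) lambda. *)
have per_ge y : lcf_purely_periodic p y (cf_period w) -> 0 <= y - lambda.
  case: (w) w0 => // -[m j] w' _ [_ /(_ 0%N)]; rewrite mod0n /= => d.
  have /andP[lo _] := digit_bounds d.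
  have mE : (m.+2%:Z - 1 = m.+1%:Z)%R by rewrite -addn1 PoszD addrK.
  rewrite mE -pmulrn -natr1 in lo.
  by have := mulr_ge0 (ler0n R m) (ltW lambda_gt0); lra.
suff: z - lambda = alpha_mx (gen_prod w) by lra.
apply: (contract_unique nG dG c0 (ltW a0) fG) => n.
elim: n z per => [|n IH] z per.
  exists (z - lambda); first exact: per_ge.
  by rewrite expr0 mobius1.
have [z' fz' per'] := periodic_follows per.
have [y y0 yE] := IH z' per'.
exists y => //; rewrite exprS nonneg_mobiusM //; last exact: nonneg_diag1X.
rewrite -yE; have := @follows_gen_inv w (z' - lambda) z okw (per_ge _ per').
by rewrite subrK => /(_ fz') {1}->; ring.
Qed.

Lemma alpha_shift M N q : S ^+ q * N = M * S ^+ q -> N 1 0 != 0 ->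
  alpha_mx M = alpha_mx N + q%:R * lambda.
Proof.
rewrite SmxX; set l := q%:R * lambda => e c0.
have e00 := congr1 (fun A : 'M[R]_2 => A 0 0) e.
have e10 := congr1 (fun A : 'M[R]_2 => A 1 0) e.
have e11 := congr1 (fun A : 'M[R]_2 => A 1 1) e.
rewrite /= !mulmx2E !mx2E in e00 e10 e11.
have E10 : M 1 0 = N 1 0 by lra.
have E00 : M 0 0 = N 0 0 + l * N 1 0 by lra.
have E11 : M 1 1 = N 1 1 - l * N 1 0 by rewrite E10 in e11; lra.
rewrite /alpha_mx E10 E00 E11.
have -> : N 0 0 + l * N 1 0 + (N 1 1 - l * N 1 0) = N 0 0 + N 1 1 by ring.
by field.
Qed.

(** * Rotations of the generator product and the poles *)

Lemma gword_cat w1 w2 : gword (w1 ++ w2) = gword w1 ++ gword w2.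
Proof. by rewrite /gword map_cat flatten_cat. Qed.

(** The cut falls after q letters 1 of some block and before its last letter; a cut between two
    blocks counts as q = 0 in the right-hand one, which exists since y is nonempty. *)
Lemma gword_split w x y : gword w = x ++ y -> y != [::] ->
  exists w1 m j w2 q, [/\ w = w1 ++ (m, j) :: w2, (q <= m)%N,
    x = gword w1 ++ nseq q 1%N & y = rcons (nseq (m - q) 1%N) j ++ gword w2].
Proof.
elim: w x => [|[m j] w IH] x; first by case: x => //= <-.
rewrite /gword /= -/(gword w) => e y0.
case: (leqP (size x) m) => hx.
  exists [::], m, j, w, (size x).
  have xE : x = nseq (size x) 1%N.
    have := congr1 (take (size x)) e; rewrite [in RHS]take_size_cat //.
    by rewrite -cats1 -catA takel_cat ?size_nseq // take_nseq // => /esym.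
  split=> //; move: e; rewrite {1}xE -{1}(subnKC hx) nseqD rcons_cat -catA.
  by move/eqP; rewrite eqseq_cat // eqxx => /eqP.
have xE : x = rcons (nseq m 1%N) j ++ drop m.+1 x.
  have := congr1 (take m.+1) e; rewrite take_size_cat ?size_rcons ?size_nseq //.
  by rewrite takel_cat // => ->; rewrite cat_take_drop.
move: e; rewrite xE -catA => /eqP; rewrite eqseq_cat // eqxx /= => /eqP e.
have [w1 [m' [j' [w2 [q [wE qm xE' yE]]]]]] := IH _ e y0.
exists ((m, j) :: w1), m', j', w2, q; split=> //; first by rewrite wE.
by rewrite xE' /gword /= catA.
Qed.

Definition beta_gen w t : R := alpha_mx (gen_prod (rot t w)) + lambda.

Lemma tr_gen_rot w t : \tr (gen_prod (rot t w)) = \tr (gen_prod w).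
Proof.
rewrite -{2}(cat_take_drop t w) /rot !gen_prodE !gword_cat !wprod_cat.
by rewrite -!mulmxE mxtrace_mulC.
Qed.

Lemma gen_ok_rot w t : gen_ok w -> gen_ok (rot t w).
Proof. by rewrite /gen_ok /rot all_cat andbC -all_cat cat_take_drop. Qed.

Lemma gen_posmx w : gen_ok w -> 2 < \tr (gen_prod w) -> posmx (gen_prod w).
Proof.
move=> ok t; rewrite gen_prodE; apply: wprod_posmx => //; first exact: gword_letter.
by rewrite -gen_prodE gtr0_norm //; lra.
Qed.

Lemma is_beta_gen w : gen_word p w -> 2 < \tr (gen_prod w) ->
  is_beta p w (beta_gen w).
Proof.
move=> [w0 ok] tG t _ z; have ok' := gen_ok_rot t ok.
apply: periodic_gen; rewrite ?tr_gen_rot //; first by rewrite /gen_word size_rot.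
by apply: gen_posmx => //; rewrite tr_gen_rot.
Qed.

(** Conjugating y x by S^q completes its first block and gives the rotation starting at (m, j). The
    shift by q lambda, together with the lambda in [beta_gen], yields the exponent q + 1. *)
Lemma alpha_rot w1 m j w2 q :
  let w := w1 ++ (m, j) :: w2 in
  let x := gword w1 ++ nseq q 1%N in
  let y := rcons (nseq (m - q) 1%N) j ++ gword w2 in
  (q <= m)%N -> gen_ok w -> 2 < \tr (gen_prod w) ->
  [/\ gword w = x ++ y, posmx (wprod (y ++ x)) &
    alpha_mx (wprod (y ++ x)) = mobius (S ^- q.+1) (beta_gen w (size w1))].
Proof.
move=> w x y qm ok tG.
have wE : gword w = x ++ y.
  rewrite /x /y /w gword_cat {2}/gword /= -/(gword w2) -!catA; congr (_ ++ _).
  by rewrite catA -rcons_cat -nseqD subnKC.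
have ly : all letter (y ++ x) by rewrite all_cat andbC -all_cat -wE gword_letter.
have tE : \tr (wprod (y ++ x)) = \tr (gen_prod w).
  by rewrite gen_prodE wE !wprod_cat -!mulmxE mxtrace_mulC.
have pN : posmx (wprod (y ++ x)).
  by apply: wprod_posmx => //; rewrite tE gtr0_norm //; lra.
split=> //; rewrite mobius_SXV /beta_gen rot_size_cat.
rewrite [in RHS](@alpha_shift _ (wprod (y ++ x)) q).
- by rewrite -natr1; ring.
- rewrite gen_prodE -Vmx1 -wprod_nseq -!wprod_cat; congr wprod.
  rewrite /y /x /gword /= -/(gword _) -/(gword (w2 ++ w1)) gword_cat -!catA.
  by rewrite catA -rcons_cat -nseqD subnKC.
- by have [_ _ c0 _] := pN; rewrite gt_eqF.
Qed.

Lemma Zset_gen w : gen_word p w -> prim_hyp p (gen_prod w) ->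
  Zset p (bqf_class p (Qmx (gen_prod w))) = shifted_betas p w (beta_gen w).
Proof.
move=> [w0 ok] pG; have nG := nonneg_gen ok.
have tG0 : 0 < \tr (gen_prod w) by case: nG => *; rewrite tr2E; lra.
have tG := prim_hyp_gt2 pG tG0; have lw := gword_letter ok.
apply/seteqP; split=> z.
  move=> /(ZsetE hp _ pG tG0) [A [hA + ->]]; rewrite gen_prodE => pN.
  have [|x [y [vE NE]]] := conj_wprod_split hp lw _ hA pN; first by rewrite -gen_prodE.
  (* Cutting at the end gives the same rotation as cutting at the beginning. *)
  wlog y0 : x y vE NE / y != [::] => [hw|].
    case: (eqVneq y [::]) => y0; last exact: (hw x y).
    apply: (hw [::] x); [by rewrite vE y0 cats0 | by rewrite NE y0 cats0 |].
    apply/eqP=> x0; move: tG; rewrite gen_prodE vE x0 y0 wprod_nil mx2_1 tr2E !mx2E.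
    by lra.
  have [w1 [m [j [w2 [q [wE qm xE yE]]]]]] := gword_split vE y0.
  rewrite wE in ok tG; have [_ _ aE] := alpha_rot qm ok tG.
  exists (size w1), q.+1; split.
  - by rewrite wE size_cat /= -addSnnS ltn_addr.
  - by rewrite wE nth_cat ltnn subnn.
  - by rewrite NE xE yE wE aE.
move=> [t [i [tw + ->]]].
have wE : w = take t w ++ nth (0%N, 0%N) w t :: drop t.+1 w.
  by rewrite -drop_nth // cat_take_drop.
have st : size (take t w) = t by rewrite size_take tw.
move: wE st; set w1 := take t w; set w2 := drop t.+1 w.
case: (nth _ w t) => m j; move: w1 w2 => w1 w2 wE st; case: i => // q /=.
rewrite ltnS => qm.
have ok' := ok; have tG' := tG; rewrite wE in ok' tG'.
have [gE pN aE] := alpha_rot qm ok' tG'.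
rewrite -st wE; move: gE pN aE.
set x := _ ++ nseq q _; set y := _ ++ gword w2 => gE pN <-; rewrite -wE in gE *.
apply/(ZsetE hp _ pG tG0); exists (wprod x)^-1.
have NE : (wprod x)^-1 * gen_prod w * (wprod x)^-1^-1 = wprod (y ++ x).
  rewrite gen_prodE gE invrK (wprod_cat R p x y) (wprod_cat R p y x) mulKr //.
  exact: det2_unit (det2_wprod R p x).
by rewrite NE; split=> //; apply/GammaV/Gamma_wprod.
Qed.

End ContinuedFractions.

(** * Recovering the conjugacy class from the poles *)

(** T sends z to -1/z, so its images of simple numbers are negative. *)
Lemma Pset_pos (R : realType) (p : nat) (A : set (bqf R)) :
  [set z | Pset p A z /\ 0 < z] = Zset p A.
Proof.
apply/seteqP; split=> z; last by move=> h; split; [left | case: h => -[_ /andP[]]].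
move=> [[//|[y [[_ /andP[_ y0]] _] <-]]].
rewrite /mobius !mx2E mul0r add0r mul1r addr0 pmulr_lgt0 ?invr_gt0 //.
by rewrite ltr0N1.
Qed.

Theorem theorem3p3 (R : realType) (p : nat) (hp : (3 <= p)%N) :
  [/\
      forall C : set (set 'M[R]_2), prim_hyp_class p C ->
        hyperbolic_bqf_class p (forms_of p C) /\
        forall M : 'M[R]_2, C (pm M) -> 0 < \tr M ->
          forms_of p C = bqf_class p (Qmx M),
      set_bij (@prim_hyp_class R p) (@isp R p) (fun C => Pset p (forms_of p C))
    & forall (C : set (set 'M[R]_2)) (w : seq (nat * nat)),
        prim_hyp_class p C -> gen_word p w -> C (pm (gen_prod R p w)) ->
        exists2 beta : nat -> R, is_beta p w beta &
          Zset p (forms_of p C) = shifted_betas p w beta /\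
          [set z | Pset p (forms_of p C) z /\ 0 < z] = Zset p (forms_of p C)].
Proof.
have formsM (M : 'M[R]_2) : prim_hyp p M -> 0 < \tr M ->
    forms_of p (conj_class p M) = bqf_class p (Qmx M).
  by move=> pM tM; apply: forms_ofE => //; apply: conj_class_id.
have hypM (M : 'M[R]_2) : prim_hyp p M -> 0 < \tr M ->
    hyperbolic_bqf_class p (bqf_class p (Qmx M)).
  move=> pM tM; exists (Qmx M) => //; split; last by exists M.
  have hM := prim_hyp_Gamma pM.
  have : bqf_class p (Qmx M) (Qmx M).
    apply/(bqf_classE _ hM); exists 1; first exact: Gamma1.
    by rewrite mul1r invr1 mulr1.
  by case.
split.
- move=> C /class_rep [M [pM tM ->]]; rewrite formsM //; split; first exact: hypM.
  by move=> N CN tN; rewrite -(forms_ofE pM tM CN tN) formsM.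
- split.
  + move=> C /class_rep [M [pM tM ->]]; exists (bqf_class p (Qmx M)).
      exact: hypM.
    by rewrite formsM.
  + move=> C D /set_mem /class_rep [M [pM tM CE]] /set_mem /class_rep [N [pN tN DE]].
    rewrite CE DE !formsM // => PE.
    have ZE : Zset p (bqf_class p (Qmx M)) = Zset p (bqf_class p (Qmx N)).
      by rewrite -!Pset_pos PE.
    (* Cyclic reduction supplies a positive conjugate of M, hence a point of the common set of
       positive poles. *)
    have [A [v [hA lv h]]] := hyperbolic_conj_wprod hp pM.1.
    have tA : 0 < \tr (A * M * A^-1) by rewrite tr2_conj // (Gamma_det2 hA).
    have vE : A * M * A^-1 = wprod R p v.
      have [a _ _ d] := nonneg_diag1_wprod R hp lv.
      by case: h => // h; move: tA; rewrite h tr2N tr2E => tA; exfalso; lra.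
    have pos : posmx (A * M * A^-1).
      rewrite vE; apply: wprod_posmx => //; rewrite -vE tr2_conj ?(Gamma_det2 hA) //.
      by case: pM => -[].
    have : Zset p (bqf_class p (Qmx M)) (alpha_mx (A * M * A^-1)).
      by apply/(ZsetE hp _ pM tM); exists A.
    set z := alpha_mx _ => Zz; have Zz' := Zz; rewrite ZE in Zz'.
    (* The form of this single point lies in both classes, so M and N are conjugate to matrices with
       equal forms, hence to the same matrix. *)
    have [_ QM] := Zz; have [_ QN] := Zz'.
    have [B hB BE] := (bqf_classE _ (prim_hyp_Gamma pM)).1 QM.
    have [D' hD DE'] := (bqf_classE _ (prim_hyp_Gamma pN)).1 QN.
    rewrite -(conj_class_conj M hB) -(conj_class_conj N hD); congr conj_class.
    have dB := Gamma_det2 hB; have dD := Gamma_det2 hD.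
    apply: Qmx_inj; rewrite ?tr2_conj -?BE -?DE' //.
      exact/Gamma_det2/prim_hyp_Gamma/(prim_hyp_conj hB).
    exact/Gamma_det2/prim_hyp_Gamma/(prim_hyp_conj hD).
  + move=> P [A [Q [_ [M [pM tM ->]]] ->] ->].
    by exists (conj_class p M); [exists M | rewrite formsM].
- move=> C w /class_rep [M [pM tM ->]] gw CW.
  have nG := nonneg_gen R hp gw.2.
  have tG0 : 0 < \tr (gen_prod R p w) by case: nG => *; rewrite tr2E; lra.
  have [A hA GE] := (class_mem pM tM tG0).1 CW.
  have pG : prim_hyp p (gen_prod R p w) by rewrite GE; apply: prim_hyp_conj.
  exists (beta_gen R p w); first by apply: is_beta_gen (prim_hyp_gt2 pG tG0).
  rewrite Pset_pos (forms_ofE pM tM CW tG0); split=> //.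
  exact: Zset_gen.
Qed.
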